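(* For all $n \in \mathbb N$, $n\ge1$, there exists a constant $C = C(n)\geq 0$ with the following property: for any $\alpha \in [0,1[$ and $u \in \mathrm{BV}^\alpha_c(\mathbb R^n)$ with $\operatorname{spt}(u) \subset [-r,r]^n$ for some $r > 0$ there is a sequence $(u_k)_{k \geq 0}$ in $\mathrm{BV}_c(\mathbb R^n)$ such that: (1) The partial sums of $\sum_k u_k$ converge to $u$ in $L^1$. (2) $\operatorname{spt}(u_k) \subset [-r,r]^n$ for all $k \geq 0$. (3) For all $k \geq 0$, \[\|u_k\|_{L^1} \leq C\,r^{1-\alpha}\,\mathbf V^\alpha(u)\, 2^{k(\alpha-1)} \quad\text{and}\quad \mathbf V(u_k) \leq C\,r^{-\alpha}\,\mathbf V^\alpha(u)\, 2^{k\alpha}.\] (4) $u_k = \sum_{R \in \mathscr P_k} a_R \chi_R$, where $a_R \in \mathbb R$, $\mathscr P_0 = \{[-r,r]^n\}$ and $\mathscr P_k = \{r2^{1-k}(p + [0,1]^n) : p \in \mathbb Z^n\}$ for $k \geq 1$.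
   Context: $L^1_c(\mathbb R^n)$ denotes integrable functions with (essentially) compact support. For $\alpha\in[0,1]$, $\mathrm{Lip}^\alpha(g)=\sup_{x\ne y}|g(x)-g(y)|/|x-y|^\alpha$ and $\mathrm{Lip}=\mathrm{Lip}^1$. For $u\in L^1_c(\mathbb R^n)$, $\mathbf V^\alpha(u)$ is the smallest $C\in[0,\infty]$ such that $\bigl|\int_{\mathbb R^n} u\det D(f,g^1,\dots,g^{n-1})\,dx\bigr|\le C\,\mathrm{Lip}^\alpha(f)\,\mathrm{Lip}(g^1)\cdots\mathrm{Lip}(g^{n-1})$ for all $f,g^1,\dots,g^{n-1}\in\mathrm{Lip}(\mathbb R^n)$, and $\mathrm{BV}^\alpha_c(\mathbb R^n)=\{u\in L^1_c(\mathbb R^n):\mathbf V^\alpha(u)<\infty\}$. $\mathbf V(u)=\sup\{\int u\operatorname{div}\varphi\,dx:\varphi\in C_c^1(\mathbb R^n,\mathbb R^n),\|\varphi\|_\infty\le1\}$ is the classical total variation and $\mathrm{BV}_c(\mathbb R^n)=\{u\in L^1_c(\mathbb R^n):\mathbf V(u)<\infty\}$. *)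

(* Defs.v *)
From HB Require Import structures.
From mathcomp Require Import all_boot all_order all_algebra.
From mathcomp Require Import all_classical all_reals all_analysis.

Set Implicit Arguments.
Unset Strict Implicit.
Unset Printing Implicit Defensive.

Import Order.TTheory GRing.Theory Num.Theory.
Import numFieldNormedType.Exports.

Local Open Scope classical_set_scope.
Local Open Scope ring_scope.

(* R^n is the type 'rV[R]_n of row vectors. Its sigma-algebra is generated by
   the coordinate maps, as for n.-tuple in the library; it is the Borel one. *)
Definition rV_display : measure_display.
Proof. exact: default_measure_display. Qed.

Section measurable_rV.
Context {R : realType}.
Variable n : nat.

Let coor (i : 'I_n) (x : 'rV[R]_n) : measurableTypeR R := x ord0 i.

Let rV_set0 : g_sigma_preimage coor set0.
Proof. exact: sigma_algebra0. Qed.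

Let rV_setC A : g_sigma_preimage coor A -> g_sigma_preimage coor (~` A).
Proof. exact: sigma_algebraC. Qed.

Let rV_bigcup (F : _^nat) : (forall i, g_sigma_preimage coor (F i)) ->
  g_sigma_preimage coor (\bigcup_i (F i)).
Proof. exact: sigma_algebra_bigcup. Qed.

HB.instance Definition _ := @isMeasurable.Build rV_display
  'rV[R]_n (g_sigma_preimage coor) rV_set0 rV_setC rV_bigcup.

End measurable_rV.

Lemma measurable_coor {R : realType} n (i : 'I_n) :
  measurable_fun [set: 'rV[R]_n] (fun x => x ord0 i : measurableTypeR R).
Proof.
move=> _ Y mY; rewrite setTI; apply: sub_sigma_algebra => /=.
rewrite -bigcup_seq/=; exists i => /=; first by rewrite mem_index_enum.
by exists Y => //; rewrite setTI.
Qed.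

Lemma measurable_fun_rVP {R : realType} d (T : measurableType d) n
    (f : T -> 'rV[R]_n) :
  (forall i, measurable_fun [set: T] (fun t => f t ord0 i : measurableTypeR R)) ->
  measurable_fun [set: T] f.
Proof.
move=> mf _ Y mY; rewrite setTI.
move: Y mY; apply: smallest_sub.
  split=> [|A mA|F mF] /=.
  - by rewrite preimage_set0.
  - by rewrite setTD preimage_setC; exact: measurableC.
  - by rewrite preimage_bigcup; exact: bigcup_measurable.
move=> A /=; rewrite -bigcup_seq => -[i _] /= [B mB <-].
by rewrite setTI -[X in measurable X]setTI; exact: mf.
Qed.

Definition cons_rV {R : realType} n (x : measurableTypeR R * 'rV[R]_n) :
  'rV[R]_n.+1 := row_mx (x.1)%:M x.2.

(* n-dimensional Lebesgue measure: the n-fold product of the one-dimensional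
   one, transported along R * R^n ~ R^n.+1. *)
Fixpoint lebesgue_rV {R : realType} n : set 'rV[R]_n -> \bar R :=
  match n with
  | 0 => dirac (0 : 'rV[R]_0)
  | m.+1 => pushforward (lebesgue_measure \x lebesgue_rV (n := m))%E (@cons_rV R m)
  end.

Lemma cons_rV0 {R : realType} n (x : measurableTypeR R * 'rV[R]_n) :
  cons_rV x ord0 ord0 = x.1.
Proof.
rewrite /cons_rV (_ : @ord0 n = lshift n (ord0 : 'I_1)); last exact: val_inj.
by rewrite (row_mxEl (x.1)%:M x.2) mxE.
Qed.

Lemma cons_rVS {R : realType} n (x : measurableTypeR R * 'rV[R]_n) i :
  cons_rV x ord0 (lift ord0 i) = x.2 ord0 i.
Proof.
rewrite /cons_rV (_ : lift (@ord0 n) i = rshift 1 i); last exact: val_inj.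
by rewrite (row_mxEr (x.1)%:M x.2).
Qed.

Lemma measurable_cons_rV {R : realType} n :
  measurable_fun setT (@cons_rV R n).
Proof.
apply: measurable_fun_rVP => i.
have [->|[j ->]] : i = ord0 \/ exists j, i = lift ord0 j.
- by case: (unliftP ord0 i) => [j ->|->]; [right; exists j|left].
- rewrite (_ : (fun t => _) = fst); first exact: measurable_fst.
  by apply/funext => t; rewrite cons_rV0.
- rewrite (_ : (fun t => _) = (fun v : 'rV[R]_n => v ord0 j) \o snd).
    exact: (measurableT_comp (@measurable_coor R n j) (@measurable_snd _ _ _ _)).
  by apply/funext => t; rewrite cons_rVS.
Qed.

Definition uncons_rV {R : realType} n (v : 'rV[R]_n.+1) :
    measurableTypeR R * 'rV[R]_n := (v ord0 ord0, rsubmx (v : 'rV_(1 + n))).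

Lemma measurable_uncons_rV {R : realType} n :
  measurable_fun setT (@uncons_rV R n).
Proof.
apply: measurable_fun_pair; first exact: measurable_coor.
apply: measurable_fun_rVP => i.
rewrite (_ : (fun t => _) = (fun v : 'rV[R]_n.+1 => v ord0 (rshift 1 i))).
  exact: measurable_coor.
by apply/funext => v /=; rewrite mxE.
Qed.

Lemma cons_rVK {R : realType} n : cancel (@cons_rV R n) (@uncons_rV R n).
Proof.
move=> x; rewrite /uncons_rV cons_rV0 [RHS]surjective_pairing; congr pair.
exact: row_mxKr.
Qed.

Lemma product_measure_sigma_finite d1 d2 (T1 : measurableType d1)
    (T2 : measurableType d2) (R : realType)
    (m1 : {sigma_finite_measure set T1 -> \bar R})
    (m2 : {sigma_finite_measure set T2 -> \bar R}) :
  sigma_finite setT (m1 \x m2)%E.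
Proof.
have /sigma_finiteP[F [TF ndF Foo]] := sigma_finiteT m1.
have /sigma_finiteP[G [TG ndG Goo]] := sigma_finiteT m2.
exists (fun n => F n `*` G n).
  rewrite -setXTT TF TG; apply/seteqP; split=> -[x y] /=.
    move=> [[n _ Fnx] [k _ Gky]]; exists (maxn n k) => //; split.
      by move: x Fnx; exact/subsetPset/ndF/leq_maxl.
    by move: y Gky; exact/subsetPset/ndG/leq_maxr.
  by move=> [n _ [Fx Gy]]; split; exists n.
move=> k; have [mF Fk] := Foo k; have [mG Gk] := Goo k.
split; first exact: measurableX.
by rewrite product_measure1E// lte_mul_pinfty// ge0_fin_numE.
Qed.

Lemma pushforward_sigma_finite d1 d2 (T1 : measurableType d1)
    (T2 : measurableType d2) (R : realType) (m : {measure set T1 -> \bar R})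
    (f : T1 -> T2) (g : T2 -> T1) :
  sigma_finite setT m -> measurable_fun setT f -> measurable_fun setT g ->
  cancel f g ->
  exists m' : {sigma_finite_measure set T2 -> \bar R}, pushforward m f = m'.
Proof.
move=> [F FT Foo] mf mg fK.
have nu_sigma_finite : sigma_finite setT (pushforward m f).
  exists (fun n => g @^-1` F n).
    by rewrite -preimage_bigcup -FT preimage_setT.
  move=> n; have [mF Fn] := Foo n; split.
    by rewrite -[X in measurable X]setTI; exact: mg.
  rewrite /pushforward -comp_preimage (_ : g \o f = id) ?preimage_id//.
  exact/funext.
pose nu : {measure set T2 -> \bar R} :=
  measure_function_pushforward__canonical__measure_function_Measure m mf.
pose nuS := Measure_isSigmaFinite.Build _ _ _ nu nu_sigma_finite.
pose m' : {sigma_finite_measure set T2 -> \bar R} :=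
  HB.pack (nu : set T2 -> \bar R) (Measure.class nu) nuS.
by exists m'.
Qed.

Lemma lebesgue_rV_sigma_finite {R : realType} n :
  exists m : {sigma_finite_measure set 'rV[R]_n -> \bar R},
    @lebesgue_rV R n = m.
Proof.
elim: n => [|n [m IHn]].
  by exists (dirac (0 : 'rV[R]_0)).
rewrite /= IHn.
exact: (pushforward_sigma_finite
  (product_measure_sigma_finite lebesgue_measure m)
  (@measurable_cons_rV R n) (@measurable_uncons_rV R n) (@cons_rVK R n)).
Qed.

Section lebesgue_rV_measure.
Context {R : realType}.
Variable n : nat.

Let mu := @lebesgue_rV R n.

Let mu0 : mu set0 = 0%E.
Proof. by rewrite /mu; have [m ->] := @lebesgue_rV_sigma_finite R n. Qed.

Let mu_ge0 A : (0 <= mu A)%E.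
Proof. by rewrite /mu; have [m ->] := @lebesgue_rV_sigma_finite R n. Qed.

Let mu_sigma_additive : semi_sigma_additive mu.
Proof.
rewrite /mu; have [m ->] := @lebesgue_rV_sigma_finite R n.
exact: measure_semi_sigma_additive.
Qed.

HB.instance Definition _ := isMeasure.Build _ _ _ (@lebesgue_rV R n)
  mu0 mu_ge0 mu_sigma_additive.

Let mu_sigma_finite : sigma_finite setT mu.
Proof.
rewrite /mu; have [m ->] := @lebesgue_rV_sigma_finite R n.
exact: sigma_finiteT.
Qed.

HB.instance Definition _ := Measure_isSigmaFinite.Build _ _ _
  (@lebesgue_rV R n) mu_sigma_finite.

End lebesgue_rV_measure.

Lemma lebesgue_rV_box {R : realType} n (A : 'I_n -> set (measurableTypeR R)) :
  (forall i, measurable (A i)) ->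
  lebesgue_rV [set x : 'rV[R]_n | forall i, A i (x ord0 i)] =
  (\prod_(i < n) lebesgue_measure (A i))%E.
Proof.
elim: n A => [|n IHn] A mA.
  rewrite big_ord0 /= (_ : [set _ | _] = setT) ?diracT//.
  by apply/seteqP; split=> // x _ [].
rewrite big_ord_recl /= /pushforward.
pose B := [set x : 'rV[R]_n | forall i, A (lift ord0 i) (x ord0 i)].
rewrite (_ : _ @^-1` _ = A ord0 `*` B); last first.
  apply/seteqP; split=> x; rewrite /B /=.
    move=> Ax; split; first by have := Ax ord0; rewrite cons_rV0.
    by move=> i; have := Ax (lift ord0 i); rewrite cons_rVS.
  move=> [Ax Bx] i; have [j ->|->] := unliftP ord0 i.
    by rewrite cons_rVS; exact: Bx.
  by rewrite cons_rV0.
have mB : measurable B.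
  rewrite (_ : B = \bigcap_(i in [set: 'I_n])
      ((fun x : 'rV[R]_n => x ord0 i : measurableTypeR R) @^-1` A (lift ord0 i))).
    apply: fin_bigcap_measurable => // i _.
    rewrite -[X in measurable X]setTI; exact: measurable_coor.
  by apply/seteqP; split=> x /= Bx i; [move=> _|]; exact: Bx.
rewrite product_measure1E//; congr (_ * _)%E.
by apply: IHn => i; exact: mA.
Qed.

Section BV.
Context {R : realType}.

(* The norm of the library on 'rV[R]_n is the sup norm; [enorm] is the
   Euclidean one. *)
Definition enorm n (x : 'rV[R]_n) : R := Num.sqrt (\sum_(i < n) x ord0 i ^+ 2).

Definition basis_rV n (j : 'I_n) : 'rV[R]_n := delta_mx ord0 j.

(* Lip alpha g is +oo when g is not alpha-Hoelder continuous. *)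
Definition Lip n (alpha : R) (g : 'rV[R]_n -> R) : \bar R :=
  ereal_sup [set z | exists x y : 'rV[R]_n, x != y /\
    z = (`|g x - g y| / (enorm (x - y) `^ alpha))%:E].

Definition is_Lip n (g : 'rV[R]_n -> R) : Prop := (Lip 1 g < +oo)%E.

Definition spt n (u : 'rV[R]_n -> R) : set 'rV[R]_n :=
  [set x | forall U, open_nbhs x U ->
    ~ {ae @lebesgue_rV R n, forall y, U y -> u y = 0}].

(* Elements of L^1 are represented by Borel functions. *)
Definition L1c n (u : 'rV[R]_n -> R) : Prop :=
  (@lebesgue_rV R n).-integrable setT (EFin \o u) /\ compact (spt u).

(* det D(f, g^1, ..., g^n) in dimension n.+1: row 0 is the gradient of f and
   row i.+1 is the gradient of g i. For Lipschitz functions the partial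
   derivatives exist almost everywhere; elsewhere 'D has a default value. *)
Definition detD n (f : 'rV[R]_n.+1 -> R) (g : 'I_n -> 'rV[R]_n.+1 -> R)
    (x : 'rV[R]_n.+1) : R :=
  \det (\matrix_(i < n.+1, j < n.+1)
    'D_(basis_rV j) (oapp g f (unlift ord0 i)) x).

Definition Valpha n (alpha : R) (u : 'rV[R]_n.+1 -> R) : \bar R :=
  ereal_inf [set C : \bar R | (0 <= C)%E /\
    forall (f : 'rV[R]_n.+1 -> R) (g : 'I_n -> 'rV[R]_n.+1 -> R),
      is_Lip f -> (forall i, is_Lip (g i)) ->
      (`|\int[@lebesgue_rV R n.+1]_x (u x * detD f g x)|%:E
        <= C * Lip alpha f * \prod_(i < n) Lip 1 (g i))%E].

Definition BVac n (alpha : R) (u : 'rV[R]_n.+1 -> R) : Prop :=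
  L1c u /\ (Valpha alpha u < +oo)%E.

Definition div n (phi : 'rV[R]_n -> 'rV[R]_n) (x : 'rV[R]_n) : R :=
  \sum_(i < n) 'D_(basis_rV i) (fun y => phi y ord0 i) x.

Definition C1c n (phi : 'rV[R]_n -> 'rV[R]_n) : Prop :=
  [/\ forall x, differentiable phi x,
      forall i, continuous (fun x => 'D_(basis_rV i) phi x)
    & compact (closure [set x | phi x != 0])].

Definition Vtot n (u : 'rV[R]_n -> R) : \bar R :=
  ereal_sup [set (\int[@lebesgue_rV R n]_x (u x * div phi x))%:E |
    phi in [set phi | C1c phi /\ forall x, enorm (phi x) <= 1]].

Definition BVc n (u : 'rV[R]_n -> R) : Prop := L1c u /\ (Vtot u < +oo)%E.

Definition cube n (r : R) : set 'rV[R]_n :=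
  [set x | forall i, - r <= x ord0 i <= r].

Definition unit_cube n : set 'rV[R]_n :=
  [set x | forall i, 0 <= x ord0 i <= 1].

Definition dyadic n (r : R) (k : nat) : set (set 'rV[R]_n) :=
  if k is 0 then [set cube r]
  else [set [set (r * 2 ^ (1 - k%:Z)) *: (map_mx intr p + y) |
             y in @unit_cube n] | p in [set: 'rV[int]_n]].

End BV.

(* Main.v *)
(** The pieces are differences of weighted averages. On each grid cube Q of side
    l put a_Q = int u w_Q, where w_Q is a product of tents supported in Q with
    integral 1, and let u_k = sum_Q (a_Q - a_(parent of Q)) 1_Q over the cubes
    of level k (with no parent term when k = 0). The difference
    w_Q - w_(parent of Q) is Lipschitz and has mean zero, so it is the divergence
    of a Lipschitz field supported in the parent. For any signs s_Q, the sum of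
    s_Q l^d (w_Q - w_(parent of Q)) is therefore a sum of d partial derivatives
    d_i h with |h| <= C l and Lip h <= C, whence Lip^alpha h <= C l^(1-alpha); and
    int u d_i h is bounded by V^alpha(u) Lip^alpha h because d_i h is, up to sign,
    the Jacobian of h and the coordinates other than x_i. This bounds
    sum_Q |a_Q - a_(parent of Q)| l^d, hence the L^1 norm of u_k, and V(u_k) is at
    most 2 d / l times that. Smooth weights, rather than plain averages, keep the
    constant independent of alpha. *)
Require Import Defs.
From mathcomp Require Import all_boot all_order all_algebra.
From mathcomp Require Import all_classical all_reals all_analysis.
From mathcomp Require Import measurable_realfun ring lra zify.
Set Implicit Arguments.
Unset Strict Implicit.
Unset Printing Implicit Defensive.
Import Order.TTheory GRing.Theory Num.Theory.
Import numFieldNormedType.Exports.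
Local Open Scope classical_set_scope.
Local Open Scope ring_scope.

(** * Products and tents *)

(** The divergence field is explicit. A product of fine tents minus a product of coarse ones
    telescopes, one coordinate at a time, into products whose slot [i] holds fine minus coarse. That
    factor has the primitive [ramp_diff]; the other slots keep tents. Indicators in those slots
    would make [h] jump across faces, and [h] would no longer be a Lipschitz test. The derivative in
    direction [i] only meets the primitive, which is differentiable at every point, so Rademacher's
    theorem is avoided.

    Level 0 has no parent, and its weight has positive mean. The primitive [ramp] is then bounded
    but not compactly supported, which is harmless: tests are global Lipschitz functions, and there
    is a single cube to sum over.

    Convergence: off the grid hyperplanes the partial sums are the operators [approx], bounded on
    L^1 uniformly in the level and exact on functions constant on a cell. They converge on
    indicators of orthants cut to the cube, hence, by the pi-lambda theorem and closedness in L^1,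
    on every integrable function vanishing outside the cube. *)

Section products.
Context {R : realFieldType}.
Variables (d : nat).

Definition hybrid (i : 'I_d) (b m a : 'I_d -> R) (j : 'I_d) : R :=
  if (j < i)%N then b j else if j == i then m j else a j.

(** Replacing the factors [a j] by [b j] one at a time, from the left, gives a telescoping sum whose
    [i]-th step changes slot [i] only. With [a] fine and [b] coarse, each summand is a partial
    derivative in direction [i]. *)
Lemma prodB_hybrid (a b : 'I_d -> R) :
  \prod_j a j - \prod_j b j =
  \sum_i \prod_j hybrid i b (fun j => a j - b j) a j.
Proof.
pose H k := \prod_(j < d) (if (j < k)%N then b j else a j).
have -> : \prod_j a j = H 0%N by [].
have -> : \prod_j b j = H d by apply: eq_bigr => j _; rewrite ltn_ord.
rewrite -opprB -(telescope_sumr H (leq0n d)) big_mkord -sumrN.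
apply: eq_bigr => i _; rewrite opprB /H (bigD1 i)//= [X in _ - X](bigD1 i)//=.
rewrite [RHS](bigD1 i)//= /hybrid ltnn ltnSn eqxx mulrBl; congr (_ * _ - _ * _).
  by apply: eq_bigr => j /negPf->.
apply: eq_bigr => j ji; rewrite (negPf ji) ltnS leq_eqVlt.
by have -> : (j == i :> nat) = false by exact: negPf ji.
Qed.

(** A sum over multi-indices of products of one-variable factors is the product of the one-variable
    sums, so a bound in dimension one passes to the grid without a factor counting the cubes. *)
Lemma tensor_bound N (A : 'I_d -> 'I_N -> R) (c : R) :
  (forall j, \sum_m `|A j m| <= c) ->
  \sum_(p : {ffun 'I_d -> 'I_N}) `|\prod_j A j (p j)| <= c ^+ d.
Proof.
move=> Ac; under eq_bigr do rewrite normr_prod.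
rewrite -(bigA_distr_bigA (fun j m => `|A j m|)).
rewrite -[X in _ ^+ X]card_ord -prodr_const.
by apply: ler_prod => j _; rewrite Ac sumr_ge0.
Qed.

Lemma tensor_lip N (A B : 'I_d -> 'I_N -> R) (c e : R) :
  (forall j, \sum_m `|A j m| <= c) -> (forall j, \sum_m `|B j m| <= c) ->
  (forall j, \sum_m `|A j m - B j m| <= c * e) ->
  \sum_(p : {ffun 'I_d -> 'I_N}) `|\prod_j A j (p j) - \prod_j B j (p j)|
    <= d%:R * c ^+ d * e.
Proof.
move=> Ac Bc ABc.
under eq_bigr do rewrite prodB_hybrid.
apply: (@le_trans _ _ (\sum_(p : {ffun 'I_d -> 'I_N}) \sum_i
    `|\prod_j hybrid i (fun j => B j (p j)) (fun j => A j (p j) - B j (p j))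
        (fun j => A j (p j)) j|)).
  by apply: ler_sum => p _; exact: ler_norm_sum.
rewrite exchange_big/= -mulrA -[X in X%:R]card_ord mulr_natl -sumr_const.
apply: ler_sum => i _; under eq_bigr do rewrite normr_prod.
(* For fixed [i] the hybrid product still has one factor per coordinate, so its sum factorises: slot
   [i] contributes at most [c * e], every other slot at most [c]. *)
pose h j m := `|hybrid i (fun j => B j m) (fun j => A j m - B j m) (fun j => A j m) j|.
rewrite (_ : \sum_(_ | _) _ = \prod_j \sum_m h j m); last first.
  by rewrite (bigA_distr_bigA h).
have h0 j : 0 <= \sum_m h j m by apply: sumr_ge0 => m _; exact: normr_ge0.
have c0 : 0 <= c by apply: le_trans (Ac i); exact: sumr_ge0.
rewrite (bigD1 i)//=.
have -> : c ^+ d * e = c * e * \prod_(j < d | j != i) c.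
  by rewrite mulrAC -[in RHS](@bigD1 _ _ _ _ i xpredT (fun=> c))// prodr_const card_ord.
apply: ler_pM => //; first exact: prodr_ge0.
- by rewrite /h /hybrid ltnn eqxx; exact: ABc.
- apply: ler_prod => j ji; rewrite h0/=.
  rewrite /h /hybrid (negPf ji).
  by case: (j < i)%N; [exact: Bc|exact: Ac].
Qed.

End products.

Section tent.
Context {R : realType}.
Implicit Types t s : R.

(** The piecewise linear bump on [0,1] with height 2 at 1/2, hence integral 1. Written with absolute
    values, it gets its Lipschitz bound, its continuity and an explicit primitive without case
    distinctions. *)
Definition tent t : R := 2 * (`|t| + `|t - 1| - 2 * `|t - 2^-1|).

(* [t * |t|] is a primitive of [2 * |t|]. *)
Definition ramp t : R :=
  t * `|t| + (t - 1) * `|t - 1| - 2 * ((t - 2^-1) * `|t - 2^-1|) + 2^-1.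

Lemma tent_le0 t : t <= 0 -> tent t = 0.
Proof. by move=> t0; rewrite /tent !ler0_norm; lra. Qed.

Lemma tent_ge1 t : 1 <= t -> tent t = 0.
Proof. by move=> t1; rewrite /tent !ger0_norm; lra. Qed.

Lemma tent_itv t : 0 <= tent t <= 2.
Proof.
rewrite /tent; have [t0|t0] := ger0P t; have [t1|t1] := ger0P (t - 1);
  have [t2|t2] := ger0P (t - 2^-1); apply/andP; split; lra.
Qed.

(** The constant 8 is 2 * (1 + 1 + 2), from the triangle inequality over the three absolute values;
    the true slope is 4. *)
Lemma tent_lip t s : `|tent t - tent s| <= 8 * `|t - s|.
Proof.
rewrite /tent; have H c : `| `|t - c| - `|s - c| | <= `|t - s|.
  by apply: le_trans (ler_dist_dist _ _) _; rewrite opprB addrA subrK.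
have := H 0; have := H 1; have := H 2^-1; rewrite !subr0 !ler_norml; lra.
Qed.

Lemma ramp_le0 t : t <= 0 -> ramp t = 0.
Proof. by move=> t0; rewrite /ramp !ler0_norm; [field|lra|lra|lra]. Qed.

Lemma ramp_ge1 t : 1 <= t -> ramp t = 1.
Proof. by move=> t1; rewrite /ramp !ger0_norm; [field|lra|lra|lra]. Qed.

(** At 0 the difference quotient is [|h|], which tends to 0; elsewhere the function agrees near [t]
    with [s * s] or its opposite. Hence [ramp] is differentiable even where the absolute values have
    kinks. *)
Lemma is_derive_mul_normr t : is_derive t 1 (fun s => s * `|s|) (2 * `|t|).
Proof.
have [->|t0] := eqVneq t 0.
  have dq (e : R) : 0 < e -> \forall h \near (0 : R)^',
      `|h^-1 *: ((((fun s : R => s * `|s|) \o shift 0) (h *: 1)) - 0 * `|0|)| < e.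
    move=> e0; near=> h.
    rewrite /= addr0 scaler1 normr0 mulr0 subr0 /GRing.scale/= mulrA.
    have [->|h0] := eqVneq h 0; first by rewrite mulr0 mul0r normr0.
    rewrite mulVf// mul1r normr_id; near: h.
    by apply: dnbhs0_lt.
  rewrite normr0 mulr0; apply: DeriveDef.
    by apply/cvg_ex; exists 0; apply/cvgr0Pnorm_lt => e; exact: dq.
  by apply: cvg_lim => //; apply/cvgr0Pnorm_lt => e; exact: dq.
have sq : is_derive t 1 (fun s => s * s) (2 * t).
  rewrite (_ : (fun s => s * s) = (id : R -> R) * id)//.
  by apply: is_derive_eq; rewrite /GRing.scale/=; lra.
have [tp|tn] := ltP 0 t.
  rewrite gtr0_norm//.
  apply: (near_eq_is_derive (f := fun s => s * s)) => //.
  near=> s; rewrite gtr0_norm//; near: s; exact: lt_nbhsr.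
have {}tn : t < 0 by rewrite lt_neqAle t0.
rewrite ltr0_norm// mulrN.
apply: (near_eq_is_derive (f := - (fun s : R => s * s))).
near=> s; rewrite ltr0_norm ?mulrN//; near: s; exact: lt_nbhsl.
Unshelve. all: by end_near. Qed.

Lemma is_derive_ramp t : is_derive t 1 ramp (tent t).
Proof.
have sh c : is_derive t 1 (fun s : R => (s - c) * `|s - c|) (2 * `|t - c|).
  apply: (is_derive_eq (f' := 2 * `|t - c| * 1)); last by rewrite mulr1.
  apply: (@is_derive1_comp _ (fun s => s * `|s|) (fun s => s - c)).
    exact: is_derive_mul_normr.
  rewrite (_ : (fun s => s - c) = (id : R -> R) - cst c)//.
  by apply: is_derive_eq; rewrite subr0.
have -> : ramp = (fun s => s * `|s|) + (fun s => (s - 1) * `|s - 1|) -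
    2 \*: (fun s => (s - 2^-1) * `|s - 2^-1|) + cst 2^-1 by [].
have ? := is_derive_mul_normr t.
apply: is_derive_eq.
by rewrite /tent /GRing.scale/=; lra.
Qed.

Lemma continuous_ramp : continuous ramp.
Proof.
move=> t; apply/differentiable_continuous/derivable1_diffP.
by have [] := is_derive_ramp t.
Qed.

Lemma continuous_tent : continuous tent.
Proof.
move=> t; apply: cvgM; first exact: cvg_cst.
apply: cvgB; first apply: cvgD.
- exact: norm_continuous.
- by apply: (continuous_comp (f := fun s => s - 1)) (@norm_continuous _ _ _);
    apply: cvgB; [exact: cvg_id|exact: cvg_cst].
- apply: cvgM; first exact: cvg_cst.
  by apply: (continuous_comp (f := fun s => s - 2^-1)) (@norm_continuous _ _ _);
    apply: cvgB; [exact: cvg_id|exact: cvg_cst].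
Qed.

Lemma ramp_mvt t s : t <= s -> 0 <= ramp s - ramp t <= 2 * (s - t).
Proof.
move=> ts.
have [c _ ->] := MVT_segment ts (fun x _ => is_derive_ramp x)
  (continuous_subspaceT continuous_ramp).
have /andP[c0 c2] := tent_itv c; rewrite -subr_ge0 in ts.
by rewrite mulr_ge0//= ler_wpM2r.
Qed.

Lemma ramp_lip t s : `|ramp t - ramp s| <= 2 * `|t - s|.
Proof.
wlog ts : t s / t <= s.
  move=> H; have [/H//|/ltW/H] := leP t s.
  by rewrite distrC [in leRHS]distrC.
have /andP[r0 r1] := ramp_mvt ts.
by rewrite distrC ger0_norm// distrC ger0_norm// subr_ge0.
Qed.

Lemma ramp_itv t : 0 <= ramp t <= 1.
Proof.
have [t0|t0] := leP t 0; first by rewrite ramp_le0// lexx ler01.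
have [t1|t1] := leP 1 t; first by rewrite ramp_ge1// lexx ler01.
have := ramp_mvt (ltW t0); have := ramp_mvt (ltW t1).
by rewrite (ramp_le0 (lexx 0)) (ramp_ge1 (lexx 1)); lra.
Qed.

End tent.

(** * Uniform bounds on sums over the intervals of a grid *)

Section families.
Context {R : realType}.
Implicit Types (t s : R) (m N : nat).

(* [m./2.*2, m./2.*2.+2] is the parent of the unit interval [m, m.+1]. *)
Definition in_pair m t : bool := ((m./2).*2%:R < t < (m./2).*2.+2%:R).

Lemma in_pair_half m m' t : in_pair m t -> in_pair m' t -> m./2 = m'./2.
Proof.
move=> /andP[a b] /andP[a' b'].
have := lt_trans a b'; have := lt_trans a' b; rewrite !ltr_nat; lia.
Qed.

(** Indices whose parent interval contains [t] have the same half, so parity separates them; 2 is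
    the cardinal of [bool]. *)
Lemma card_in_pair N t : (#|[pred m : 'I_N | in_pair m t]| <= 2)%N.
Proof.
rewrite -card_bool -(@card_in_imset _ _ (fun m : 'I_N => odd m)) ?max_card// => m m'.
rewrite !inE => mt mt' oo; apply: val_inj; rewrite /= -(odd_double_half m).
by rewrite oo (in_pair_half mt mt') odd_double_half.
Qed.

Lemma family_bound N (B : nat -> R) (c t : R) : 0 <= c ->
  (forall m, ~~ in_pair m t -> B m = 0) -> (forall m, `|B m| <= c) ->
  \sum_(m < N) `|B m| <= 2 * c.
Proof.
move=> c0 B0 Bc; rewrite (bigID (fun m : 'I_N => in_pair m t))/=.
rewrite [X in _ + X]big1 ?addr0; last by move=> m /B0 ->; rewrite normr0.
apply: (@le_trans _ _ (\sum_(m < N | in_pair m t) c)); first exact: ler_sum.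
rewrite sumr_const mulr_natl; apply: ler_wpMn2l => //.
by apply: leq_trans (card_in_pair N t).
Qed.

Definition fine_tent m t := tent (t - m%:R).
Definition half_coord m t := (t - (m./2).*2%:R) / 2.
(** The tent of the parent interval, shared by both children. The division by 2 makes up for the
    doubled length: the integral is 1 again, so fine minus coarse has mean zero. *)
Definition coarse_tent m t := tent (half_coord m t) / 2.
(** The primitive of fine minus coarse. Both ramps go from 0 to 1 within the parent interval, so the
    difference vanishes outside it. *)
Definition ramp_diff m t := ramp (t - m%:R) - ramp (half_coord m t).

(** The map sending [t] to the vector of the [A m t], with values in l^1, is bounded by [c] and
    [c]-Lipschitz. It is used with [c = 32] for every [N], which makes the estimates uniform in the
    level. *)
Definition lip_family N (A : 'I_N -> R -> R) (c : R) :=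
  (forall t, \sum_m `|A m t| <= c) /\
  (forall t s, \sum_m `|A m t - A m s| <= c * `|t - s|).

Lemma lip_family_pair N (A : nat -> R -> R) :
  (forall m t, ~~ in_pair m t -> A m t = 0) -> (forall m t, `|A m t| <= 2) ->
  (forall m t s, `|A m t - A m s| <= 8 * `|t - s|) ->
  lip_family (fun m : 'I_N => A m) 32.
Proof.
move=> A0 A2 A8; split=> [t|t s].
  by apply: (le_trans (family_bound N _ (A0 ^~ t) (A2 ^~ t))); lra.
(* A term is nonzero only if [t] or [s] lies in the parent interval of [m]. It is charged to [t]
   when possible and to [s] otherwise; each point is charged at most twice, whence 2 * 8 + 2 * 8 =
   32. *)
pose B t s m := if in_pair m t then A m t - A m s else 0.
have Bc u v : \sum_(m < N) `|B u v m| <= 2 * (8 * `|u - v|).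
  apply: (@family_bound _ _ _ u); first by rewrite mulr_ge0.
    by move=> m; rewrite /B => /negPf ->.
  by move=> m; rewrite /B; case: ifP => _; rewrite ?A8// normr0 mulr_ge0.
apply: (@le_trans _ _ (\sum_(m < N) (`|B t s m| + `|B s t m|))).
  apply: ler_sum => m _; rewrite /B; case: ifPn => mt.
    by rewrite lerDl.
  rewrite normr0 add0r A0// sub0r; case: ifPn => ms.
    by rewrite subr0 normrN.
  by rewrite A0// normrN.
rewrite big_split/=; have := Bc t s; have := Bc s t; rewrite (distrC s t); lra.
Qed.

(** Outside the parent interval a point is on the same side of child and parent: both tents vanish
    there, and the two ramps are both 0 or both 1. *)
Lemma in_pairN m t : ~~ in_pair m t ->
  (t - m%:R <= 0 /\ half_coord m t <= 0) \/ (1 <= t - m%:R /\ 1 <= half_coord m t).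
Proof.
rewrite /in_pair negb_and -!leNgt /half_coord.
have m1 : (m./2).*2%:R <= m%:R :> R by rewrite ler_nat; lia.
have m2 : m%:R + 1 <= (m./2).*2%:R + 2 :> R by rewrite natr1 -natrD ler_nat; lia.
rewrite -addn2 natrD; move: (m%:R) ((m./2).*2%:R : R) m1 m2 => a b m1 m2.
by move=> /orP[] tm; [left|right]; split; lra.
Qed.

Lemma half_coordB m t s : half_coord m t - half_coord m s = (t - s) / 2.
Proof. by rewrite /half_coord; field. Qed.

Lemma tent_norm t : `|tent t| <= 2.
Proof. by have /andP[? ?] := tent_itv t; rewrite ger0_norm. Qed.

Lemma lip_fine_tent N : lip_family (fun m : 'I_N => fine_tent m) 32.
Proof.
apply: lip_family_pair => [m t /in_pairN[] [h _]|m t|m t s].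
- by rewrite /fine_tent tent_le0.
- by rewrite /fine_tent tent_ge1.
- exact: tent_norm.
- by apply: (le_trans (tent_lip _ _)); rewrite opprB addrA subrK.
Qed.

Lemma lip_coarse_tent N : lip_family (fun m : 'I_N => coarse_tent m) 32.
Proof.
apply: lip_family_pair => [m t /in_pairN[] [_ h]|m t|m t s].
- by rewrite /coarse_tent tent_le0// mul0r.
- by rewrite /coarse_tent tent_ge1// mul0r.
- rewrite /coarse_tent normrM [ `|2^-1| ]ger0_norm ?invr_ge0//.
  by have := tent_norm (half_coord m t); lra.
- rewrite /coarse_tent -mulrBl normrM [ `|2^-1| ]ger0_norm ?invr_ge0//.
  have := tent_lip (half_coord m t) (half_coord m s).
  rewrite half_coordB normrM [ `|2^-1| ]ger0_norm ?invr_ge0//.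
  by have := normr_ge0 (t - s); lra.
Qed.

Lemma lip_ramp_diff N : lip_family (fun m : 'I_N => ramp_diff m) 32.
Proof.
apply: lip_family_pair => [m t /in_pairN[] [h1 h2]|m t|m t s].
- by rewrite /ramp_diff !ramp_le0// subr0.
- by rewrite /ramp_diff !ramp_ge1// subrr.
- have := ramp_itv (t - m%:R); have := ramp_itv (half_coord m t).
  by rewrite /ramp_diff ler_norml => /andP[? ?] /andP[? ?]; apply/andP; split; lra.
- have := ramp_lip (t - m%:R) (s - m%:R).
  have := ramp_lip (half_coord m t) (half_coord m s).
  rewrite half_coordB normrM [ `|2^-1| ]ger0_norm ?invr_ge0// opprB addrA subrK.
  rewrite /ramp_diff => h1 h2; have := normr_ge0 (t - s).
  have -> : forall a b c e : R, a - b - (c - e) = (a - c) - (b - e) by move=> *; ring.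
  by have := ler_normB (ramp (t - m%:R) - ramp (s - m%:R))
    (ramp (half_coord m t) - ramp (half_coord m s)); lra.
Qed.

Lemma lip_single (f : R -> R) : (forall t, `|f t| <= 2) ->
  (forall t s, `|f t - f s| <= 8 * `|t - s|) ->
  lip_family (fun _ : 'I_1 => f) 32.
Proof.
move=> f2 f8; split=> [t|t s]; rewrite big_ord1.
  by have := f2 t; lra.
by have := f8 t s; have := normr_ge0 (t - s); lra.
Qed.

Lemma is_derive_affine (g : R -> R) (a b t dg : R) :
  is_derive (a * t + b) 1 g dg -> is_derive t 1 (fun s => g (a * s + b)) (a * dg).
Proof.
move=> gdg; apply: (is_derive_eq (f' := dg * a)); last by rewrite mulrC.
apply: (@is_derive1_comp _ g (fun s => a * s + b)).
rewrite (_ : (fun s => a * s + b) = a \*: (id : R -> R) + cst b)//.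
by apply: is_derive_eq; rewrite addr0 /GRing.scale/= mulr1.
Qed.

Lemma is_derive_ramp_diff m t :
  is_derive t 1 (ramp_diff m) (fine_tent m t - coarse_tent m t).
Proof.
rewrite /ramp_diff; apply: (@is_deriveB _ _ _ (fun t => ramp (t - m%:R))
    (fun t => ramp (half_coord m t))).
  rewrite (_ : (fun t => _) = fun t => ramp (1 * t + - m%:R)); last first.
    by apply/funext => s; rewrite mul1r.
  apply: (is_derive_eq (f' := 1 * fine_tent m t)); last by rewrite mul1r.
  by apply: is_derive_affine; rewrite mul1r; exact: is_derive_ramp.
have hE s : half_coord m s = 2^-1 * s + - ((m./2).*2%:R / 2).
  by rewrite /half_coord; ring.
rewrite (_ : (fun t => _) = fun t => ramp (2^-1 * t + - ((m./2).*2%:R / 2))).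
  apply: (is_derive_eq (f' := 2^-1 * tent (half_coord m t))); last by rewrite mulrC.
  by apply: is_derive_affine; rewrite -hE; exact: is_derive_ramp.
by apply/funext => s; rewrite hE.
Qed.

End families.

(** * Lipschitz test functions *)

Section lipschitz.
Context {R : realType}.
Implicit Types (alpha r l : R).

Lemma enorm_ge0 d (x : 'rV[R]_d) : 0 <= enorm x.
Proof. exact: sqrtr_ge0. Qed.

Lemma normr_coord_le_enorm d (x : 'rV[R]_d) j : `|x ord0 j| <= enorm x.
Proof.
rewrite -sqrtr_sqr ler_sqrt; last by rewrite sumr_ge0// => i _; exact: sqr_ge0.
by rewrite (bigD1 j)//= lerDl sumr_ge0// => i _; exact: sqr_ge0.
Qed.

Lemma enorm_gt0 d (x : 'rV[R]_d) : x != 0 -> 0 < enorm x.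
Proof.
move=> x0; rewrite lt_neqAle enorm_ge0 andbT eq_sym; apply: contra x0 => /eqP e0.
apply/eqP/rowP => j; rewrite mxE; apply/eqP.
by rewrite -normr_eq0 eq_le normr_ge0 andbT -e0 normr_coord_le_enorm.
Qed.

Lemma Lip_le d alpha (g : 'rV[R]_d -> R) (B : R) :
  (forall x y, `|g x - g y| <= B * enorm (x - y) `^ alpha) ->
  (Lip alpha g <= B%:E)%E.
Proof.
move=> gB; apply: ge_ereal_sup => _ [x [y [xy ->]]].
by rewrite lee_fin ler_pdivrMr// powR_gt0// enorm_gt0// subr_eq0.
Qed.

Lemma Lip_coord d (j : 'I_d) : (Lip 1 (fun x : 'rV[R]_d => x ord0 j) <= 1%:E)%E.
Proof.
apply: Lip_le => x y; rewrite mul1r powRr1 ?enorm_ge0//.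
by have := normr_coord_le_enorm (x - y) j; rewrite !mxE.
Qed.

(** Positive dimension supplies two distinct points; the supremum of an empty set would be [-oo]. *)
Lemma Lip_ge0 d alpha (g : 'rV[R]_d.+1 -> R) : (0 <= Lip alpha g)%E.
Proof.
apply: (@le_trans _ _ (`|g 0 - g (const_mx 1)| /
    (enorm (0 - const_mx 1 : 'rV[R]_d.+1) `^ alpha))%:E).
  by rewrite lee_fin divr_ge0// powR_ge0.
apply: ereal_sup_ubound; exists 0, (const_mx 1); split => //.
apply/eqP => /rowP /(_ ord0); rewrite !mxE => /eqP.
by rewrite eq_sym oner_eq0.
Qed.

Definition scaled_coord d r l (x : 'rV[R]_d) (j : 'I_d) : R := (x ord0 j + r) / l.

Definition tensor d N (A : 'I_d -> 'I_N -> R -> R) (s : {ffun 'I_d -> 'I_N} -> R)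
    r l (x : 'rV[R]_d) : R :=
  \sum_(p : {ffun 'I_d -> 'I_N}) s p * \prod_j A j (p j) (scaled_coord r l x j).

Lemma tensor_norm_le d N (A : 'I_d -> 'I_N -> R -> R) s r l (c : R) x :
  (forall j, lip_family (A j) c) -> (forall p, `|s p| <= 1) ->
  `|tensor A s r l x| <= c ^+ d.
Proof.
move=> Ac s1; apply: le_trans (ler_norm_sum _ _ _) _.
pose a j m := A j m (scaled_coord r l x j).
apply: le_trans (tensor_bound (A := a) (fun j => (Ac j).1 _)).
by apply: ler_sum => p _; rewrite normrM ler_piMl.
Qed.

Lemma tensor_lip_le d N (A : 'I_d -> 'I_N -> R -> R) s r l (c : R) x z :
  0 <= c -> 0 < l -> (forall j, lip_family (A j) c) -> (forall p, `|s p| <= 1) ->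
  `|tensor A s r l x - tensor A s r l z| <= d%:R * c ^+ d * (enorm (x - z) / l).
Proof.
move=> c0 l0 Ac s1; rewrite /tensor -sumrB; apply: le_trans (ler_norm_sum _ _ _) _.
pose a x j m := A j m (scaled_coord r l x j).
apply: (@le_trans _ _ (\sum_(p : {ffun 'I_d -> 'I_N})
    `|\prod_j a x j (p j) - \prod_j a z j (p j)|)).
  by apply: ler_sum => p _; rewrite -mulrBr normrM ler_piMl.
apply: tensor_lip => j; [exact: (Ac j).1|exact: (Ac j).1|].
apply: le_trans ((Ac j).2 _ _) _; rewrite ler_wpM2l// /scaled_coord.
rewrite -mulrBl opprD addrACA subrr addr0 normrM ler_pM ?normr_ge0//.
  by have := normr_coord_le_enorm (x - z) j; rewrite !mxE.
by rewrite ger0_norm// invr_ge0 ltW.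
Qed.

(** Interpolation between the sup bound and the Lipschitz bound, with threshold [e = l]: below it
    [e / l] is at most its power [alpha], above it that power is at least 1. The constant is
    therefore independent of [alpha], and scaling produces the power [1 - alpha] of [l]. *)
Lemma tensor_holder d N (A : 'I_d.+1 -> 'I_N -> R -> R) s r l (c : R) alpha x z :
  0 <= c -> 0 < l -> (forall j, lip_family (A j) c) -> (forall p, `|s p| <= 1) ->
  0 <= alpha <= 1 ->
  `|l * tensor A s r l x - l * tensor A s r l z| <=
     2 * d.+1%:R * c ^+ d.+1 * l `^ (1 - alpha) * enorm (x - z) `^ alpha.
Proof.
move=> c0 l0 Ac s1 /andP[a0 a1]; rewrite -mulrBr normrM gtr0_norm//.
have cd0 : 0 <= c ^+ d.+1 by rewrite exprn_ge0.
have d1 : 1 <= d.+1%:R :> R by rewrite ler1n.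
set K := 2 * _ * _; set e := enorm _.
have e0 : 0 <= e by exact: enorm_ge0.
have el0 : 0 <= e / l by rewrite divr_ge0// ltW.
have K0 : 0 <= K by rewrite /K !mulr_ge0.
have -> : K * l `^ (1 - alpha) * e `^ alpha = l * (K * (e / l) `^ alpha).
  rewrite powRM// ?invr_ge0 ?ltW// -powR_inv1 ?ltW// -powRrM mulN1r.
  rewrite (powRD (r := 1)) ?powRr1 ?ltW//; first ring.
  by rewrite (gt_eqF l0) implybT.
rewrite ler_pM2l//.
have [h|h] := leP (e / l) 1.
  apply: le_trans (tensor_lip_le _ _ _ c0 l0 Ac s1) _.
  apply: ler_pM => //; first by rewrite mulr_ge0.
    by rewrite /K; have := mulr_ge0 (le_trans ler01 d1) cd0; lra.
  have [->|n0] := eqVneq (e / l) 0; first by rewrite powR_ge0.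
  have p0 : 0 < e / l by rewrite lt_neqAle eq_sym n0.
  by rewrite ger1_powR// p0.
apply: (@le_trans _ _ (2 * c ^+ d.+1)).
  apply: le_trans (ler_normB _ _) _.
  by have := tensor_norm_le r l x Ac s1; have := tensor_norm_le r l z Ac s1; lra.
apply: (@le_trans _ _ K).
  by rewrite /K -mulrA; have := ler_peMl cd0 d1; lra.
rewrite ler_peMr//; apply: (@le_trans _ _ ((e / l) `^ 0)); first by rewrite powRr0.
by rewrite ler_powR// ltW.
Qed.

Lemma derive_line d (f : 'rV[R]_d -> R) x v (df : R) :
  is_derive (0 : R) 1 (fun t : R => f (t *: v + x)) df -> 'D_v f x = df.
Proof.
move=> [_ <-]; rewrite /derive.
suff -> : (fun h : R => h^-1 *: ((f \o shift x) (h *: v) - f x)) =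
  (fun h => h^-1 *: (((fun t => f (t *: v + x)) \o shift 0) (h *: 1) - f (0 *: v + x))) by [].
by apply/funext => h /=; rewrite addr0 scaler1 scale0r add0r.
Qed.

Lemma is_derive_bigsum (I : Type) (q : seq I) (f : I -> R -> R) (df : I -> R) (t : R) :
  (forall i, is_derive t 1 (f i) (df i)) ->
  is_derive t 1 (fun s => \sum_(i <- q) f i s) (\sum_(i <- q) df i).
Proof.
move=> fdf; elim: q => [|i q IH].
  rewrite big_nil (_ : (fun s => _) = cst 0); first exact: is_derive_cst.
  by apply/funext => s; rewrite big_nil.
rewrite big_cons (_ : (fun s => _) = f i + (fun s => \sum_(i <- q) f i s)).
  exact: is_deriveD.
by apply/funext => s; rewrite big_cons.
Qed.

(** Along [basis_rV i] all factors but the one in slot [i] are constant, so the kinks of the tents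
    in the other slots do not matter. The chain rule produces 1 / l, which the prefactor [l]
    cancels. *)
Lemma derive_tensor d N (A : 'I_d -> 'I_N -> R -> R) s r l x i
    (a : 'I_N -> R -> R) : l != 0 ->
  (forall m (t : R), is_derive t 1 (A i m) (a m t)) ->
  'D_(basis_rV i) (fun x => l * tensor A s r l x) x =
  tensor (fun j => if j == i then a else A j) s r l x.
Proof.
move=> l0 Aa; apply: derive_line.
pose y := scaled_coord r l x.
have yE t j : scaled_coord r l (t *: basis_rV i + x) j =
    if j == i then l^-1 * t + y i else y j.
  rewrite /y /scaled_coord !mxE eqxx/= mulr_natr.
  by have [->|ji] := eqVneq j i; rewrite ?mulr1n ?mulr0n ?add0r//; ring.
pose P p := s p * \prod_(j < d | j != i) A j (p j) (y j).
rewrite (_ : (fun t => _) = fun t : R =>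
    \sum_(p : {ffun 'I_d -> 'I_N}) (l * P p) * A i (p i) (l^-1 * t + y i)); last first.
  apply/funext => t; rewrite mulr_sumr; apply: eq_bigr => p _.
  rewrite (bigD1 i)//= yE eqxx /P (eq_bigr (fun j => A j (p j) (y j))); first ring.
  by move=> j ji; rewrite yE (negPf ji).
rewrite (_ : tensor _ _ _ _ _ =
    \sum_(p : {ffun 'I_d -> 'I_N}) (l * P p) * (l^-1 * a (p i) (y i))); last first.
  apply: eq_bigr => p _; rewrite (bigD1 i)//= eqxx /P.
  rewrite (eq_bigr (fun j => A j (p j) (y j))); first by field.
  by move=> j /negPf ->.
apply: is_derive_bigsum => p.
rewrite (_ : (fun t => _) = (l * P p) \*: (fun t => A i (p i) (l^-1 * t + y i)))//.
apply: is_deriveZ; apply: is_derive_affine.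
by rewrite mulr0 add0r; exact: Aa.
Qed.

Lemma derive_coord d (j k : 'I_d) x :
  'D_(basis_rV j) (fun y : 'rV[R]_d => y ord0 k) x = (k == j)%:R.
Proof.
apply: derive_line.
rewrite (_ : (fun t => _) = (k == j)%:R \*: (id : R -> R) + cst (x ord0 k)).
  by apply: is_derive_eq; rewrite addr0 /GRing.scale/= mulr1.
by apply/funext => t; rewrite !mxE eqxx/= mulrC.
Qed.

(** In column [i] the coordinates other than [x_i] have derivative zero, so the expansion keeps a
    single entry, whose minor is the identity matrix. The other partial derivatives of [h], possibly
    default values, drop out. *)
Lemma detD_coord d (i : 'I_d.+1) (h : 'rV[R]_d.+1 -> R) x :
  detD h (fun m y => y ord0 (lift i m)) x = (-1) ^+ i * 'D_(basis_rV i) h x.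
Proof.
rewrite /detD (expand_det_col _ i) (bigD1 ord0)//= big1 ?addr0; last first.
  move=> k k0; rewrite mxE; case: unliftP k0 => [m ->|->]; last by rewrite eqxx.
  by move=> _ /=; rewrite derive_coord eq_sym (negPf (neq_lift i m)) mul0r.
rewrite mxE unlift_none/= /cofactor add0n mulrC.
congr (_ * _); rewrite (_ : row' _ _ = 1%:M) ?det1 ?mulr1//.
apply/matrixP => a b; rewrite !mxE liftK/= derive_coord.
by rewrite (inj_eq (@lift_inj _ i)).
Qed.

Lemma Valpha_ge0 d alpha (u : 'rV[R]_d.+1 -> R) : (0 <= Valpha alpha u)%E.
Proof. by apply: le_ereal_inf_tmp => C []. Qed.

Lemma Valpha_partial d alpha (u h : 'rV[R]_d.+1 -> R) i (B : R) : 0 < B ->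
  is_Lip h -> (Lip alpha h <= B%:E)%E ->
  (@lebesgue_rV R d.+1).-integrable setT
     (EFin \o (fun x => u x * 'D_(basis_rV i) h x)) ->
  (`|\int[@lebesgue_rV R d.+1]_x (u x * 'D_(basis_rV i) h x)|%:E
     <= Valpha alpha u * B%:E)%E.
Proof.
(* Dividing by the positive [B] turns the claim into a lower bound for every admissible constant,
   hence for their infimum. *)
move=> B0 hL hB iuh; rewrite -lee_pdivrMr//.
apply: le_ereal_inf_tmp => C [C0 HC]; rewrite lee_pdivrMr//.
have gL m : is_Lip (fun y : 'rV[R]_d.+1 => y ord0 (lift i m)).
  by apply: (le_lt_trans (Lip_coord _)); rewrite ltry.
have := HC h (fun m y => y ord0 (lift i m)) hL gL.
rewrite (_ : (\int[_]_x _) =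
    (-1) ^+ i * \int[@lebesgue_rV R d.+1]_x (u x * 'D_(basis_rV i) h x)); last first.
  rewrite -RintegralZl//; apply: eq_Rintegral => x _.
  by rewrite detD_coord mulrCA.
rewrite normrM normrX normrN1 expr1n mul1r => /le_trans; apply.
rewrite -[leRHS]mule1; apply: lee_pmul.
- by rewrite mule_ge0// Lip_ge0.
- by apply: prode_ge0 => m _; exact: Lip_ge0.
- exact: lee_wpmul2l.
- have /andP[]// : (0 <= \prod_(m < d) Lip 1 (fun y : 'rV[R]_d.+1 => y ord0 (lift i m)) <= 1)%E.
  elim/big_ind : _ => [|x y /andP[x0 x1] /andP[y0 y1]|m _].
  + by rewrite lee01 lexx.
  + by rewrite mule_ge0//= -[leRHS]mule1 lee_pmul.
  + by rewrite Lip_ge0/= Lip_coord.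
Qed.

End lipschitz.

(** * Lebesgue measure on row vectors *)

Section rV_measure.
Context {R : realType}.
Variable d : nat.
Implicit Types (a b : 'I_d -> R) (x : 'rV[R]_d).

Definition box a b : set 'rV[R]_d := [set x | forall j, a j <= x ord0 j <= b j].

Lemma measurable_pi (A : 'I_d -> set (measurableTypeR R)) :
  (forall j, measurable (A j)) ->
  measurable [set x : 'rV[R]_d | forall j, A j (x ord0 j)].
Proof.
move=> mA; rewrite (_ : [set _ | _] = \bigcap_(i in [set: 'I_d])
    ((fun x : 'rV[R]_d => x ord0 i : measurableTypeR R) @^-1` A i)).
  apply: fin_bigcap_measurable => // i _.
  by rewrite -[X in measurable X]setTI; exact: measurable_coor.
by apply/seteqP; split=> x /= Bx i; [move=> _|]; exact: Bx.
Qed.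

Lemma boxE a b : box a b = [set x | forall j, `[a j, b j]%classic (x ord0 j)].
Proof. by apply/seteqP; split=> x /= h j; have := h j; rewrite /= in_itv. Qed.

Lemma measurable_box a b : measurable (box a b).
Proof. rewrite boxE; apply: (measurable_pi (A := fun j => `[a j, b j]%classic)) => j.
exact: measurable_itv. Qed.

Lemma lebesgue_rV_closed_box a b : (forall j, a j <= b j) ->
  lebesgue_rV (box a b) = (\prod_(j < d) (b j - a j))%:E.
Proof.
move=> ab; rewrite boxE (lebesgue_rV_box (A := fun j => `[a j, b j]%classic)); last first.
  by move=> j; exact: measurable_itv.
rewrite -prodEFin; apply: eq_bigr => j _; rewrite lebesgue_measure_itv /= lte_fin.
by case: ltP => // ba; rewrite EFinB (@le_anti _ _ (b j) (a j)) ?subee// ba ab.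
Qed.

(** A hyperplane is a product of lines with one factor reduced to a point; its measure has a zero
    factor, and 0 times [+oo] is 0. *)
Lemma ae_coord_neq (j : 'I_d) (c : R) :
  {ae @lebesgue_rV R d, forall x, x ord0 j != c}.
Proof.
pose A i : set (measurableTypeR R) := if i == j then [set c] else setT.
have mA i : measurable (A i).
  by rewrite /A; case: ifP => _; [exact: measurable_set1|exact: measurableT].
exists [set x : 'rV[R]_d | forall i, A i (x ord0 i)]; split.
- exact: measurable_pi.
- by rewrite lebesgue_rV_box// (bigD1 j)//= /A eqxx lebesgue_measure_set1 mul0e.
- move=> x /= /negP; rewrite negbK => /eqP xc i.
  by rewrite /A; have [->|] := eqVneq i j.
Qed.

Lemma closed_box a b : closed (box a b).
Proof.
rewrite (_ : box a b = \bigcap_(j in [set: 'I_d])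
    ((fun x : 'rV[R]_d => x ord0 j) @^-1` `[a j, b j]%classic)).
  apply: closed_bigI => j _; apply: preimage_closed; last exact: interval_closed.
  by move=> x _; exact: coord_continuous.
rewrite boxE; apply/seteqP; split=> x /= h j; [move=> _|]; exact: h.
Qed.

Lemma compact_box a b : compact (box a b).
Proof.
apply: bounded_closed_compact; last exact: closed_box.
exists (\sum_j (`|a j| + `|b j|)); split; first by rewrite num_real.
move=> M hM x xab; rewrite /Num.Def.normr/= mx_normrE; apply: bigmax_le.
  by rewrite (le_trans _ (ltW hM))// sumr_ge0.
move=> [i j] _ /=; rewrite (ord1 i); apply: le_trans (ltW hM).
have /andP[h1 h2] := xab j.
rewrite (bigD1 j)//= (@le_trans _ _ (`|a j| + `|b j|))//; last first.
  by rewrite lerDl sumr_ge0.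
have := ler_norm (b j); have := ler_norm (- a j); rewrite normrN.
have := normr_ge0 (a j); have := normr_ge0 (b j).
by rewrite ler_norml => *; apply/andP; split; lra.
Qed.

(** A countable base of open boxes. It puts the open sets in the sigma-algebra generated by the
    coordinates, and it passes from local to global almost everywhere statements. *)
Definition rat_box (q : 'rV[rat]_d * 'rV[rat]_d) : set 'rV[R]_d :=
  [set x | forall j, ratr (q.1 ord0 j) < x ord0 j < ratr (q.2 ord0 j)].

Lemma measurable_rat_box q : measurable (rat_box q).
Proof.
rewrite (_ : rat_box q = [set x | forall j,
    `]ratr (q.1 ord0 j), ratr (q.2 ord0 j)[%classic (x ord0 j)]).
  apply: (measurable_pi
    (A := fun j => `]ratr (q.1 ord0 j), ratr (q.2 ord0 j)[%classic)) => j.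
  exact: measurable_itv.
by apply/seteqP; split=> x /= h j; have := h j; rewrite /= in_itv.
Qed.

Lemma open_rat_box (U : set 'rV[R]_d) x : open_nbhs x U ->
  exists2 q, rat_box q x & rat_box q `<=` U.
Proof.
move=> /open_nbhs_nbhs /nbhs_ballP[e /= e0 xU].
have H j : {q : rat * rat | (x ord0 j - e < ratr q.1 < x ord0 j) &&
    (x ord0 j < ratr q.2 < x ord0 j + e)}.
  have /rat_in_itvoo /cid[q1] : x ord0 j - e < x ord0 j by lra.
  have /rat_in_itvoo /cid[q2] : x ord0 j < x ord0 j + e by lra.
  by rewrite !in_itv /= => h2 h1; exists (q1, q2); rewrite h1.
exists (\row_j (sval (H j)).1, \row_j (sval (H j)).2).
  by move=> j /=; rewrite !mxE; case: (H j) => /= q /andP[/andP[_ ->] /andP[-> _]].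
move=> y /= yq; apply: xU; split=> // i j; rewrite (ord1 i).
have := yq j; rewrite !mxE; case: (H j) => /= q /andP[/andP[? ?] /andP[? ?]] /andP[? ?].
by rewrite /ball/= ltr_norml; apply/andP; split; lra.
Qed.

Lemma open_measurable_rV (U : set 'rV[R]_d) : open U -> measurable U.
Proof.
move=> oU; rewrite (_ : U = \bigcup_n
    (if unpickle n is Some q then
       if `[< rat_box q `<=` U >] then rat_box q else set0 else set0)).
  apply: bigcup_measurable => n _; case: unpickle => [q|//].
  by case: asboolP => _ //; exact: measurable_rat_box.
apply/seteqP; split=> [x Ux|x [n _]].
  have [q qx qU] := @open_rat_box U x (conj oU Ux).
  by exists (pickle q) => //; rewrite pickleK; case: asboolP.
by case: unpickle => [q|//]; case: asboolP => // qU; exact: qU.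
Qed.

Lemma continuous_measurable_rV (f : 'rV[R]_d -> R) :
  continuous f -> measurable_fun setT (f : 'rV[R]_d -> measurableTypeR R).
Proof.
move=> cf; apply: (measurability _ (measurable_realfun.RGenOpens.measurableE R)) => //.
move=> _ [_ [a [b ->] <-]]; rewrite setTI; apply: open_measurable_rV.
by move/continuousP : cf; apply; exact: interval_open.
Qed.

(** Each point off the support lies in a rational box on which [u] vanishes almost everywhere, and
    countably many null sets have a null union. *)
Lemma spt_sub_ae (u : 'rV[R]_d -> R) (K : set 'rV[R]_d) :
  closed K -> spt u `<=` K ->
  {ae @lebesgue_rV R d, forall x, ~ K x -> u x = 0}.
Proof.
move=> cK uK.
pose P q := {ae @lebesgue_rV R d, forall x, rat_box q x -> u x = 0}.
(* The premise [P q] makes the statement vacuous for boxes on which [u] does not vanish almost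
   everywhere, so that all codes can be treated at once. *)
have : {ae @lebesgue_rV R d, forall x, forall n : nat,
    if unpickle n is Some q then P q -> rat_box q x -> u x = 0 else True}.
  apply/ae_foralln => n; case: unpickle => [q|]; last exact: aeW.
  have [Pq|nP] := pselect (P q); last exact: aeW.
  by apply: filterS Pq => x h _.
apply: filterS => x hx nKx.
have /existsNP[U /not_implyP[xU /contrapT uU]] : ~ spt u x by move=> /uK.
have [q qx qU] := open_rat_box xU.
have := hx (pickle q); rewrite pickleK; apply => //.
by apply: filterS uU => y h /qU.
Qed.

End rV_measure.

(** * Fubini's theorem on row vectors *)

Section fubini_rV.
Context {R : realType}.
Local Open Scope ereal_scope.

Lemma ge0_integral_cons_rV n (F : 'rV[R]_n.+1 -> \bar R) :
  measurable_fun setT F -> (forall x, 0 <= F x) ->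
  \int[@lebesgue_rV R n.+1]_x F x =
  \int[@lebesgue_measure R]_t \int[@lebesgue_rV R n]_x F (cons_rV (t, x)).
Proof.
move=> mF F0.
transitivity (\int[@lebesgue_measure R \x @lebesgue_rV R n]_z F (cons_rV z)).
  exact: (ge0_integral_pushforward (@measurable_cons_rV R n)
    (@lebesgue_measure R \x @lebesgue_rV R n) measurableT mF).
rewrite fubini_tonelli1//.
by apply: measurableT_comp => //; exact: measurable_cons_rV.
Qed.

Lemma integrable_cons_rV n (F : 'rV[R]_n.+1 -> \bar R) :
  (@lebesgue_rV R n.+1).-integrable setT F ->
  (@lebesgue_measure R \x @lebesgue_rV R n).-integrable setT (F \o cons_rV (n:=n)).
Proof.
move=> /integrableP[mF Foo]; apply/integrableP; split.
  by apply: measurableT_comp => //; exact: measurable_cons_rV.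
apply: le_lt_trans Foo; rewrite le_eqVlt; apply/orP; left; apply/eqP/esym.
have mF' : measurable_fun setT (abse \o F) by exact: measurableT_comp.
apply: (ge0_integral_pushforward (@measurable_cons_rV R n)
    (@lebesgue_measure R \x @lebesgue_rV R n) measurableT mF') => y _.
exact: abse_ge0.
Qed.

Lemma integral_cons_rV n (F : 'rV[R]_n.+1 -> \bar R) :
  (@lebesgue_rV R n.+1).-integrable setT F ->
  \int[@lebesgue_rV R n.+1]_x F x =
  \int[@lebesgue_measure R \x @lebesgue_rV R n]_z F (cons_rV z).
Proof.
move=> iF; have /integrableP[mF _] := iF.
apply: (integral_pushforward (@measurable_cons_rV R n)
    (mu := @lebesgue_measure R \x @lebesgue_rV R n) mF _ measurableT).
exact: integrable_cons_rV.
Qed.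

Lemma measurable_tensor_rV d (phi : 'I_d -> R -> R) :
  (forall j, measurable_fun setT (phi j : measurableTypeR R -> R)) ->
  measurable_fun setT (fun x : 'rV[R]_d => \prod_j phi j (x ord0 j))%R.
Proof.
move=> mphi; apply: measurable_prod => j _.
exact: (measurableT_comp (mphi j) (@measurable_coor R d j)).
Qed.

Lemma integral_tensor_rV d (phi : 'I_d -> R -> R) :
  (forall j, measurable_fun setT (phi j : measurableTypeR R -> R)) ->
  (forall j t, 0 <= phi j t)%R ->
  \int[@lebesgue_rV R d]_x (\prod_j phi j (x ord0 j))%:E =
  \prod_(j < d) \int[@lebesgue_measure R]_t (phi j t)%:E.
Proof.
elim: d phi => [|d IH] phi mphi phi0.
  rewrite big_ord0 /= integral_dirac//=; last first.
    by apply/measurable_EFinP; exact: measurable_tensor_rV.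
  by rewrite diracT mul1e big_ord0.
rewrite ge0_integral_cons_rV; last 2 first.
- by apply/measurable_EFinP; exact: measurable_tensor_rV.
- by move=> x; rewrite lee_fin prodr_ge0.
pose C := \prod_(j < d) \int[@lebesgue_measure R]_t (phi (lift ord0 j) t)%:E.
have C0 : 0 <= C by apply: prode_ge0 => j _; apply: integral_ge0 => t _; rewrite lee_fin.
transitivity (\int[@lebesgue_measure R]_t (C * (phi ord0 t)%:E)).
  apply: eq_integral => t _.
  under eq_integral do (rewrite big_ord_recl cons_rV0/= EFinM;
    under eq_bigr do rewrite cons_rVS/=).
  rewrite ge0_integralZl//.
  - by rewrite (IH (fun j => phi (lift ord0 j)))// muleC.
  - apply/measurable_EFinP.
    exact: (measurable_tensor_rV (phi := fun j => phi (lift ord0 j))).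
  - by move=> x _; rewrite lee_fin prodr_ge0.
  - by rewrite lee_fin.
rewrite ge0_integralZl//; last 2 first.
- exact/measurable_EFinP.
- by move=> t _; rewrite lee_fin.
by rewrite big_ord_recl muleC.
Qed.

Lemma abse_integral_le_support dd (T : measurableType dd)
    (mu : {measure set T -> \bar R}) (D : set T) (G : T -> \bar R) (c : \bar R) :
  measurable D -> measurable_fun setT G -> 0 <= c ->
  (forall x, D x -> `|G x| <= c) -> (forall x, ~ D x -> G x = 0) ->
  `|\int[mu]_x G x| <= c * mu D.
Proof.
move=> mD mG c0 Gc G0.
have -> : \int[mu]_x G x = \int[mu]_(x in D) G x.
  rewrite [RHS]integral_mkcond; apply: eq_integral => x _; rewrite patchE.
  by case: ifPn => // /negP; rewrite inE => /G0.
have mGD : measurable_fun D G by exact: measurable_funTS.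
apply: le_trans (le_abse_integral mu mD mGD) _.
by apply: integral_le_bound => //; exact: aeW.
Qed.

Definition update d (x : 'rV[R]_d) (i : 'I_d) (t : R) : 'rV[R]_d :=
  (\row_j if j == i then t else x ord0 j)%R.

(** Fubini with direction [i] integrated innermost. By induction on the dimension, the first
    coordinate is either direction [i] itself or an outer variable over which the bound in the
    remaining coordinates is integrated. *)
Lemma slice_bound d (i : 'I_d) (a b : 'I_d -> R) (h : 'rV[R]_d -> R) (M m : R) :
  (forall j, a j <= b j)%R -> (0 <= m)%R ->
  measurable_fun setT h -> (forall x, box a b x -> `|h x| <= M)%R ->
  (forall x, box a b x ->
    `|\int[@lebesgue_measure R]_(t in `[a i, b i]) (h (update x i t))%:E| <= m%:E) ->
  `|\int[@lebesgue_rV R d]_(x in box a b) (h x)%:E| <=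
    (m * \prod_(j < d | j != i) (b j - a j))%:E.
Proof.
elim: d i a b h m => [[]//|d IH] i a b h m ab m0 mh hM hm.
pose a' j := a (lift ord0 j); pose b' j := b (lift ord0 j).
have mbox := measurable_box a b; have mbox' := measurable_box a' b'.
have boxcons t x : box a b (cons_rV (t, x)) <->
    (`[a ord0, b ord0]%classic t /\ box a' b' x).
  rewrite /= in_itv/=; split=> [H|[H0 H1] j].
    split; first by have := H ord0; rewrite cons_rV0.
    by move=> j; have := H (lift ord0 j); rewrite cons_rVS.
  by case: (unliftP ord0 j) => [k ->|->]; rewrite ?cons_rVS ?cons_rV0//; exact: H1.
pose H : 'rV[R]_d.+1 -> \bar R := (EFin \o h) \_ (box a b).
have boxoo : lebesgue_rV (box a b) < +oo by rewrite lebesgue_rV_closed_box// ltry.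
have iH : (@lebesgue_rV R d.+1).-integrable setT H.
  apply/(integrable_mkcond _ mbox); apply: measurable_bounded_integrable => //.
  - exact: measurable_funTS.
  - by exists M; split; rewrite ?num_real// => y My x /hM /le_trans; apply; exact: ltW.
have iHc := integrable_cons_rV iH.
have HE t x : H (cons_rV (t, x)) =
    if (t \in `[a ord0, b ord0]%classic) && (x \in box a' b')
    then (h (cons_rV (t, x)))%:E else 0.
  rewrite /H patchE; congr (if _ then _ else _).
  apply/idP/andP => [|[/set_mem tab /set_mem xb]]; last by apply/mem_set/boxcons.
  by move=> /set_mem/boxcons[? ?]; split; exact: mem_set.
rewrite integral_mkcond -/H integral_cons_rV//.
have [ei|[k ei]] : i = ord0 \/ exists k, i = lift ord0 k.
- by case: (unliftP ord0 i) => [k ->|->]; [right; exists k|left].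
- rewrite -(integral21_prod_meas1 iHc).
  apply: le_trans (abse_integral_le_support (D := box a' b') (c := m%:E) _ _ _ _ _ _) _ => //.
  + exact: (measurable_fubini_G iHc).
  + move=> x xb; rewrite /fubini_G.
    (* [update] overwrites coordinate [i], so any value in the interval serves as base point;
       [a ord0] is one. *)
    have := hm (cons_rV (a ord0, x)); rewrite ei => /(_ _) h1.
    apply: le_trans (h1 _); last first.
      by apply/boxcons; split; rewrite //= in_itv/= lexx ab.
    rewrite [in leRHS]integral_mkcond le_eqVlt; apply/orP; left; apply/eqP.
    congr (`| _ |); apply: eq_integral => t _; rewrite patchE /= HE.
    rewrite (mem_set xb) andbT; case: ifP => // _.
    congr ((h _)%:E); apply/rowP => j; rewrite [RHS]mxE.
    case: (unliftP ord0 j) => [k ->|->]; last by rewrite eqxx cons_rV0.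
    by rewrite lift_eqF/= !cons_rVS.
  + move=> x xb; rewrite /fubini_G; apply: integral0_eq => t _ /=.
    by rewrite HE (memNset xb) andbF.
  + rewrite [X in _ * X](_ : _ = (\prod_(j < d) (b' j - a' j))%:E); last first.
      by apply: lebesgue_rV_closed_box => j; exact: ab.
    by rewrite -EFinM lee_fin ei [in leRHS]big_mkcond big_ord_recl/= mul1r.
- rewrite -(integral12_prod_meas1 iHc).
  pose m' := (m * \prod_(j < d | j != k) (b' j - a' j))%R.
  have m'0 : (0 <= m')%R.
    by rewrite mulr_ge0// prodr_ge0// => j _; rewrite subr_ge0; exact: ab.
  apply: le_trans (abse_integral_le_support (c := m'%:E)
    (D := `[a ord0, b ord0]%classic : set (measurableTypeR R)) _ _ _ _ _ _) _ => //.
  + exact: (measurable_fubini_F iHc).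
  + move=> t tab; rewrite /fubini_F.
    have -> : \int[@lebesgue_rV R d]_x (H \o cons_rV (n:=d)) (t, x) =
        \int[@lebesgue_rV R d]_(x in box a' b') (h (cons_rV (t, x)))%:E.
      rewrite [RHS]integral_mkcond; apply: eq_integral => x _; rewrite patchE /= HE.
      by rewrite (mem_set tab).
    apply: IH => //.
    * by move=> j; exact: ab.
    * apply: (measurableT_comp mh); apply: (measurableT_comp (@measurable_cons_rV R d)).
      exact: measurable_pair1.
    * by move=> x xb; apply: hM; apply/boxcons.
    * move=> x xb; have := hm (cons_rV (t, x)); rewrite ei => h1.
      apply: le_trans (h1 _); last by apply/boxcons.
      rewrite le_eqVlt; apply/orP; left; apply/eqP; congr (`| _ |).
      apply: eq_integral => s _; congr ((h _)%:E); apply/rowP => j; rewrite [RHS]mxE.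
      case: (unliftP ord0 j) => [l ->|->]; last by rewrite !cons_rV0.
      by rewrite !cons_rVS mxE /= (inj_eq (@lift_inj _ ord0)).
  + move=> t tab; rewrite /fubini_F; apply: integral0_eq => x _ /=.
    by rewrite HE (memNset tab).
  + rewrite /= lebesgue_measure_itv/= lte_fin.
    have -> : (if (a ord0 < b ord0)%R then (b ord0)%:E - (a ord0)%:E else 0) =
        (b ord0 - a ord0)%:E :> \bar R.
      case: ltP => // ba; have := ab ord0; rewrite EFinB => ab0.
      by rewrite (@le_anti _ _ (b ord0) (a ord0)) ?subee// ba ab0.
    rewrite -EFinM lee_fin ei [in leRHS]big_mkcond big_ord_recl/=.
    rewrite /m' -mulrA [in leRHS](mulrC (b _ - _)%R).
    rewrite le_eqVlt; apply/orP; left; apply/eqP.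
    congr (_ * (_ * _))%R; rewrite big_mkcond; apply: eq_bigr => j _.
    by rewrite (inj_eq (@lift_inj _ ord0)).
Qed.

End fubini_rV.

(** * Total variation of step functions *)

Lemma Rintegral_sum dd (T : measurableType dd) (R : realType)
    (mu : {measure set T -> \bar R}) (I : Type) (s : seq I) (f : I -> T -> R) :
  (forall i, mu.-integrable setT (EFin \o f i)) ->
  \int[mu]_x (\sum_(i <- s) f i x) = \sum_(i <- s) \int[mu]_x f i x.
Proof.
move=> If; elim: s => [|i s IH].
  rewrite big_nil /Rintegral integral0_eq// => x _; by rewrite big_nil.
rewrite big_cons -IH -RintegralD//.
  by apply: eq_Rintegral => x _; rewrite big_cons.
rewrite (_ : EFin \o _ = (fun x => \sum_(i <- s) (EFin \o f i) x)%E).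
  exact: integrable_sum.
by apply/funext => x /=; rewrite sumEFin.
Qed.

Lemma integrable_sumr dd (T : measurableType dd) (R : realType)
    (mu : {measure set T -> \bar R}) (I : Type) (s : seq I) (f : I -> T -> R) :
  (forall i, mu.-integrable setT (EFin \o f i)) ->
  mu.-integrable setT (EFin \o (fun x => \sum_(i <- s) f i x)).
Proof.
move=> If; rewrite (_ : EFin \o _ = (fun x => \sum_(i <- s) (EFin \o f i) x)%E).
  exact: integrable_sum.
by apply/funext => x /=; rewrite sumEFin.
Qed.

Lemma integrable_scale dd (T : measurableType dd) (R : realType)
    (mu : {measure set T -> \bar R}) (c : R) (f : T -> R) :
  mu.-integrable setT (EFin \o f) ->
  mu.-integrable setT (EFin \o (fun x => c * f x)).
Proof.
move=> If; rewrite (_ : EFin \o _ = (fun x => c%:E * (EFin \o f) x)%E)//.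
exact: integrableZl.
Qed.

Lemma indicM dd (T : measurableType dd) (R : realType) (D : set T) (f : T -> R) :
  (fun x => \1_D x * f x) = f \_ D.
Proof.
by apply/funext => x; rewrite patchE indicE; case: (x \in D); rewrite ?mul1r ?mul0r.
Qed.

Section total_variation.
Context {R : realType}.

Lemma is_derive_line d (f : 'rV[R]_d -> R) (x v : 'rV[R]_d) (t df : R) :
  is_derive (t *: v + x) v f df -> is_derive t 1 (fun s : R => f (s *: v + x)) df.
Proof.
have E : (fun h : R => h^-1 *: ((f \o shift (t *: v + x)) (h *: v) - f (t *: v + x))) =
    (fun h => h^-1 *: (((fun s => f (s *: v + x)) \o shift t) (h *: 1) - f (t *: v + x))).
  by apply/funext => h /=; rewrite scaler1 scalerDl addrA.
by move=> [fd fdf]; split; [move: fd; rewrite /derivable E|rewrite -fdf /derive E].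
Qed.

Lemma update_line d (x : 'rV[R]_d) i t :
  update x i t = t *: basis_rV i + update x i 0.
Proof.
apply/rowP => j; rewrite !mxE eqxx/=.
by case: eqVneq => _; rewrite ?mulr1 ?addr0// mulr0 add0r.
Qed.

Lemma continuous_update d (x : 'rV[R]_d) i : continuous (update x i).
Proof.
rewrite (_ : update x i = fun t => t *: basis_rV i + update x i 0); last first.
  by apply/funext => t; exact: update_line.
by move=> t; apply: cvgD; [exact: scalel_continuous|exact: cvg_cst].
Qed.

Lemma C1c_coord d (phi : 'rV[R]_d -> 'rV[R]_d) i : C1c phi ->
  (forall x, derivable (fun y => phi y ord0 i) x (basis_rV i)) /\
  continuous (fun x => 'D_(basis_rV i) (fun y => phi y ord0 i) x).
Proof.
move=> [dphi cphi _].
have D x : derivable phi x (basis_rV i) by apply: diff_derivable.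
split; first by move=> x; have /derivable_mxP := D x; exact.
rewrite (_ : (fun x => _) = (fun M : 'rV[R]_d => M ord0 i) \o ('D_(basis_rV i) phi)).
  by move=> x; apply: continuous_comp; [exact: cphi|exact: coord_continuous].
by apply/funext => x /=; rewrite derive_mx// mxE.
Qed.

(** On each segment parallel to [basis_rV i] the fundamental theorem gives a difference of two
    values of a component of [phi], each at most 1 in absolute value: the flux through two opposite
    faces. *)
Lemma partial_box d (phi : 'rV[R]_d -> 'rV[R]_d) i (a b : 'I_d -> R) :
  C1c phi -> (forall x, enorm (phi x) <= 1) -> (forall j, a j <= b j) ->
  let h x := 'D_(basis_rV i) (fun y => phi y ord0 i) x in
  (@lebesgue_rV R d).-integrable (box a b) (EFin \o h) /\
  `|\int[@lebesgue_rV R d]_(x in box a b) h x| <=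
     2 * \prod_(j < d | j != i) (b j - a j).
Proof.
move=> Cphi phi1 ab h; have [D ch] := C1c_coord i Cphi.
have mh : measurable_fun setT (h : 'rV[R]_d -> measurableTypeR R).
  exact: continuous_measurable_rV.
have [M [_ hM]] := compact_bounded (continuous_compact (continuous_subspaceT ch)
  (compact_box (a := a) (b := b))).
have {}hM x : box a b x -> `|h x| <= `|M| + 1.
  by move=> xab; apply: hM; [rewrite ltr_pwDr// ler_norm|exists x].
have boxoo : (lebesgue_rV (box a b) < +oo)%E by rewrite lebesgue_rV_closed_box// ltry.
have ih : (@lebesgue_rV R d).-integrable (box a b) (EFin \o h).
  apply: measurable_bounded_integrable.
  - exact: measurable_box.
  - exact: boxoo.
  - exact: measurable_funTS.
  - exists (`|M| + 1); split; rewrite ?num_real// => y My x /hM /le_trans; apply.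
    exact: ltW.
split=> //; rewrite -lee_fin EFin_normr_Rintegral//; last exact: measurable_box.
apply: (@slice_bound _ _ i a b h (`|M| + 1) 2) => // x xab.
have [abi|] := ltP (a i) (b i); last first.
  move=> bai; have -> : b i = a i by apply/le_anti; rewrite bai ab.
  by rewrite set_itv1 integral_set1// abse0.
pose F t := phi (update x i t) ord0 i.
have dF (t : R) : is_derive t 1 F (h (update x i t)).
  rewrite (_ : F = fun t : R => phi (t *: basis_rV i + update x i 0) ord0 i); last first.
    by apply/funext => s; rewrite /F update_line.
  apply: (@is_derive_line _ (fun y => phi y ord0 i)); rewrite -update_line.
  by apply: derivableP; exact: D.
have cF : continuous F.
  by move=> t; apply/differentiable_continuous/derivable1_diffP; have [] := dF t.
rewrite (@continuous_FTC2 _ (fun t => h (update x i t)) F _ _ abi).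
- rewrite -EFinB lee_fin; apply: le_trans (ler_normB _ _) _.
  have F1 t : `|F t| <= 1 by apply: le_trans (phi1 _); exact: normr_coord_le_enorm.
  by rewrite (_ : 2 = 1 + 1)// lerD.
- apply: continuous_subspaceT => t.
  by apply: continuous_comp; [exact: continuous_update|exact: ch].
- split; first by move=> t _; have [] := dF t.
  + by apply: cvg_at_right_filter; exact: cF.
  + by apply: cvg_at_left_filter; exact: cF.
- by move=> t _; rewrite derive1E; have [] := dF t.
Qed.

(** Each cube contributes at most [|c p|] times its perimeter [2 * d.+1 * l ^ d]. Neighbours are
    combined by the triangle inequality, so overlaps and cancellations need no analysis. *)
Lemma Vtot_step_le d (I : finType) (c : I -> R) (a b : I -> 'I_d.+1 -> R) (l : R) :
  0 <= l -> (forall p j, b p j - a p j = l) ->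
  (Vtot ((fun x : 'rV[R]_d.+1 => \sum_p c p * \1_(box (a p) (b p)) x)%R) <=
   (2 * d.+1%:R * l ^+ d * \sum_p `|c p|)%:E)%E.
Proof.
move=> l0 abl; apply: ge_ereal_sup => _ [phi [Cphi phi1] <-]; rewrite lee_fin.
have ab p j : a p j <= b p j by rewrite -subr_ge0 abl.
pose h i x := 'D_(basis_rV i) (fun y => phi y ord0 i) x.
have H p i := partial_box i Cphi phi1 (ab p).
pose f (q : I * 'I_d.+1) x := c q.1 * (\1_(box (a q.1) (b q.1)) x * h q.2 x).
have mb q : measurable (box (a q) (b q)) by exact: measurable_box.
have If0 q : (@lebesgue_rV R d.+1).-integrable setT
    (EFin \o (fun x => \1_(box (a q.1) (b q.1)) x * h q.2 x)).
  by rewrite indicM -restrict_EFin; apply/(integrable_mkcond _ (mb q.1)); case: (H q.1 q.2).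
have If q : (@lebesgue_rV R d.+1).-integrable setT (EFin \o f q).
  exact: integrable_scale.
rewrite (_ : Rintegral _ _ _ = \sum_q \int[@lebesgue_rV R d.+1]_x f q x); last first.
  rewrite -Rintegral_sum//; apply: eq_Rintegral => x _.
  rewrite mulr_suml -(pair_bigA _ (fun p i => f (p, i) x))/=; apply: eq_bigr => p _.
  by rewrite /div mulr_sumr; apply: eq_bigr => i _; rewrite /f mulrA.
apply: le_trans (ler_norm _) _; apply: le_trans (ler_norm_sum _ _ _) _.
rewrite -(pair_bigA _ (fun p i => `|\int[@lebesgue_rV R d.+1]_x f (p, i) x|))/=.
rewrite mulr_sumr; apply: ler_sum => p _.
rewrite (_ : 2 * d.+1%:R * l ^+ d * `|c p| = \sum_(i < d.+1) (`|c p| * (2 * l ^+ d))).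
  apply: ler_sum => i _; rewrite RintegralZl; [|exact: measurableT|exact: (If0 (p, i))].
  rewrite normrM ler_wpM2l// indicM -Rintegral_mkcond.
  apply: le_trans (H p i).2 _; rewrite ler_wpM2l//.
  under eq_bigr do rewrite abl.
  by rewrite prodr_const cardC1 card_ord.
by rewrite sumr_const card_ord -mulr_natl; ring.
Qed.

End total_variation.

(** * Grids and weighted averages *)

Section cells.
Context {R : realType}.
Variables (d : nat) (r : R).
Hypothesis r0 : 0 < r.
Implicit Types (k : nat) (P : 'I_d -> nat) (x : 'rV[R]_d).

Definition side k : R := 2 * r / 2 ^+ k.

Lemma side_gt0 k : 0 < side k.
Proof. by rewrite /side divr_gt0 ?exprn_gt0 ?mulr_gt0. Qed.

Lemma side_neq0 k : side k != 0.
Proof. by rewrite gt_eqF ?side_gt0. Qed.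

Lemma sideS k : side k = 2 * side k.+1.
Proof. by rewrite /side exprS; field; rewrite expf_neq0. Qed.

(** Indices count from the corner with all coordinates [- r]: cells of the cube have indices below
    [2 ^ k], and halving an index gives the parent. Natural numbers at every level avoid casts
    between levels. *)
Definition cell k P : set 'rV[R]_d :=
  box (fun j => - r + side k * (P j)%:R) (fun j => - r + side k * (P j).+1%:R).

Lemma cell_side k P j :
  - r + side k * (P j).+1%:R - (- r + side k * (P j)%:R) = side k.
Proof. by rewrite -natr1; ring. Qed.

Lemma cell_ordered k P j :
  - r + side k * (P j)%:R <= - r + side k * (P j).+1%:R.
Proof. by rewrite -subr_ge0 cell_side ltW ?side_gt0. Qed.

Lemma measurable_cell k P : measurable (cell k P).
Proof. exact: measurable_box. Qed.

Lemma lebesgue_cell k P : lebesgue_rV (cell k P) = (side k ^+ d)%:E.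
Proof.
rewrite lebesgue_rV_closed_box; last exact: cell_ordered.
by under eq_bigr do rewrite cell_side; rewrite prodr_const card_ord.
Qed.

Lemma cubeE : @cube R d r = box (fun=> - r) (fun=> r).
Proof. by []. Qed.

Lemma cell0 P : (forall j, P j = 0%N) -> cell 0 P = cube r.
Proof.
move=> P0; rewrite cubeE /cell; congr box; apply/funext => j; rewrite P0 /side expr0.
  by rewrite mulr0 addr0.
by field.
Qed.

Lemma cell_sub_cube k P : (forall j, (P j < 2 ^ k)%N) -> cell k P `<=` cube r.
Proof.
move=> Pk x xP j; have /andP[x1 x2] := xP j; apply/andP; split.
  by apply: le_trans x1; rewrite lerDl mulr_ge0 ?ler0n// ltW ?side_gt0.
apply: le_trans x2 _.
apply: (@le_trans _ _ (- r + side k * 2 ^+ k)).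
  by rewrite lerD2l ler_pM2l ?side_gt0// -natrX ler_nat.
by rewrite /side divfK ?expf_neq0//; lra.
Qed.

Lemma cell_parent k P x : cell k.+1 P x -> cell k (fun j => (P j)./2) x.
Proof.
move=> xP j; have /andP[/= x1 x2] := xP j; have s0 := side_gt0 k.+1.
rewrite /= sideS; move: (side k.+1) s0 x1 x2 => s s0 x1 x2.
apply/andP; split; [apply: le_trans x1|apply: (le_trans x2)];
  rewrite lerD2l (mulrC 2 s) -mulrA ler_pM2l// -(natrM _ 2) ler_nat; lia.
Qed.

(* Points off all the grid hyperplanes, where the closed cells do not overlap. *)
Definition generic x := forall k (j : 'I_d) (m : nat), x ord0 j != - r + side k * m%:R.

Lemma ae_generic : {ae @lebesgue_rV R d, forall x, generic x}.
Proof.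
have : {ae @lebesgue_rV R d, forall x, forall n : nat,
    if unpickle n is Some q then x ord0 q.1.2 != - r + side q.1.1 * (q.2 : nat)%:R
    else true}.
  apply/ae_foralln => n; case: unpickle => [q|]; last exact: aeW.
  exact: ae_coord_neq.
apply: filterS => x hx k j m; have := hx (pickle (k, j, m)).
by rewrite pickleK.
Qed.

Lemma generic_cell_lt k P x j : generic x -> cell k P x ->
  - r + side k * (P j)%:R < x ord0 j < - r + side k * (P j).+1%:R.
Proof.
by move=> gx /(_ j) /andP[x1 x2]; rewrite !lt_neqAle x1 x2 eq_sym !gx.
Qed.

Lemma generic_cell_uniq k P P' x : generic x -> cell k P x -> cell k P' x ->
  forall j, P j = P' j.
Proof.
move=> gx xP xP' j.
have /andP[a1 a2] := generic_cell_lt j gx xP.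
have /andP[b1 b2] := generic_cell_lt j gx xP'.
have := lt_trans a1 b2; have := lt_trans b1 a2.
by rewrite !ltrD2l !ltr_pM2l ?side_gt0// !ltr_nat; lia.
Qed.

Lemma generic_cell_ex k x : generic x -> cube r x ->
  exists p : {ffun 'I_d -> 'I_(2 ^ k)}, cell k (fun j => p j) x.
Proof.
move=> gx Qx.
have y0 j : 0 <= scaled_coord r (side k) x j.
  by have /andP[? _] := Qx j; rewrite /scaled_coord divr_ge0 ?(ltW (side_gt0 _))//; lra.
have H j : (Num.truncn (scaled_coord r (side k) x j) < 2 ^ k)%N.
  rewrite truncn_lt_nat// natrX /scaled_coord ltr_pdivrMr ?side_gt0//.
  rewrite mulrC /side divfK ?expf_neq0//.
  have /andP[_ x1] := Qx j; rewrite lt_neqAle; apply/andP; split; last by lra.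
  (* The face on which coordinate [j] equals [r] is the level 0 hyperplane of index 1, so genericity
     excludes it and the bound by [2 ^ k] is strict. *)
  have := gx 0%N j 1%N; rewrite /side expr0 mulr1 divr1.
  by apply: contra => /eqP xr; apply/eqP; lra.
exists [ffun j => Ordinal (H j)] => j /=; rewrite ffunE /=.
have /andP[h1 h2] := truncn_itv (y0 j).
move: h1 h2; rewrite /scaled_coord ler_pdivlMr ?side_gt0// ltr_pdivrMr ?side_gt0//.
by rewrite mulrC [X in _ < X -> _]mulrC => ? ?; apply/andP; split; lra.
Qed.

Definition step k (c : ('I_d -> nat) -> R) x : R :=
  \sum_(p : {ffun 'I_d -> 'I_(2 ^ k)}) c (fun j => p j) * \1_(cell k (fun j => p j)) x.

Lemma step_generic k c x (p : {ffun 'I_d -> 'I_(2 ^ k)}) : generic x ->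
  cell k (fun j => p j) x -> step k c x = c (fun j => p j).
Proof.
move=> gx xp; rewrite /step (bigD1 p)//= indicE mem_set// mulr1 big1 ?addr0// => q qp.
rewrite indicE memNset ?mulr0// => xq; move/eqP: qp; apply; apply/ffunP => j.
by apply: val_inj; exact: (generic_cell_uniq gx xq xp).
Qed.

Lemma step_outside k c x : ~ cube r x -> step k c x = 0.
Proof.
move=> Qx; rewrite /step big1// => p _; rewrite indicE memNset ?mulr0// => xp.
by apply: Qx; apply: (cell_sub_cube _ xp) => j; exact: ltn_ord.
Qed.

Lemma integrable_indic_fin (D : set 'rV[R]_d) : measurable D ->
  (lebesgue_rV D < +oo)%E -> (@lebesgue_rV R d).-integrable setT (EFin \o \1_D).
Proof.
move=> mD Doo; apply/integrableP; split; first exact/measurable_EFinP.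
under eq_integral => x _ do rewrite /= ger0_norm//.
by rewrite integral_indic// setIT.
Qed.

Lemma Rintegral_indic_cell k P : \int[@lebesgue_rV R d]_x \1_(cell k P) x = side k ^+ d.
Proof.
rewrite /Rintegral integral_indic ?setIT; last exact: measurable_cell.
  by rewrite -[RHS]/(fine (side k ^+ d)%:E); congr fine; exact: lebesgue_cell.
exact: measurableT.
Qed.

Lemma integrable_indic_cell k P :
  (@lebesgue_rV R d).-integrable setT (EFin \o \1_(cell k P)).
Proof.
apply: integrable_indic_fin; first exact: measurable_cell.
by rewrite lebesgue_cell ltry.
Qed.

Lemma integrable_step k c : (@lebesgue_rV R d).-integrable setT (EFin \o step k c).
Proof.
apply: integrable_sumr => p; apply: integrable_scale; exact: integrable_indic_cell.
Qed.

Lemma integrable_normr (f : 'rV[R]_d -> R) :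
  (@lebesgue_rV R d).-integrable setT (EFin \o f) ->
  (@lebesgue_rV R d).-integrable setT (EFin \o (fun x => `|f x|)).
Proof. by move=> fi; exact: (integrable_abse fi). Qed.

Lemma step_L1 k c : \int[@lebesgue_rV R d]_x `|step k c x| <=
  side k ^+ d * \sum_(p : {ffun 'I_d -> 'I_(2 ^ k)}) `|c (fun j => p j)|.
Proof.
pose F x := \sum_(p : {ffun 'I_d -> 'I_(2 ^ k)})
  `|c (fun j => p j)| * \1_(cell k (fun j => p j)) x.
have Fi (p : {ffun 'I_d -> 'I_(2 ^ k)}) : (@lebesgue_rV R d).-integrable setT
    (EFin \o (fun x => `|c (fun j => p j)| * \1_(cell k (fun j => p j)) x)).
  by apply: integrable_scale; exact: integrable_indic_cell.
apply: (@le_trans _ _ (\int[@lebesgue_rV R d]_x F x)).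
  apply: le_Rintegral => //.
  - by apply: integrable_normr; exact: integrable_step.
  - exact: integrable_sumr.
  - move=> x _; apply: le_trans (ler_norm_sum _ _ _) _; apply: ler_sum => p _.
    by rewrite normrM [X in _ * X]ger0_norm.
rewrite Rintegral_sum// mulr_sumr; apply: ler_sum => p _.
rewrite RintegralZl//; last exact: integrable_indic_cell.
by rewrite Rintegral_indic_cell mulrC.
Qed.

End cells.

Lemma integrable_mul_bounded dd (T : measurableType dd) (R : realType)
    (mu : {measure set T -> \bar R}) (f h : T -> R) (M : R) :
  mu.-integrable setT (EFin \o f) -> measurable_fun setT h ->
  (forall x, `|h x| <= M) ->
  mu.-integrable setT (EFin \o (fun x => f x * h x)).
Proof.
move=> If mh hM.
rewrite (_ : EFin \o _ = ((EFin \o f) \* (EFin \o h))%E)//.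
apply: integrableMl => //; exists M; split; first exact: num_real.
by move=> y My x _ /=; exact: le_trans (hM x) (ltW My).
Qed.

(** * Weighted averages and their bounds in L^1 *)

Section averages.
Context {R : realType}.
Variables (d : nat) (r : R).
Hypothesis r0 : 0 < r.
Implicit Types (k : nat) (P : 'I_d -> nat) (x : 'rV[R]_d) (f g : 'rV[R]_d -> R).
Let mu := @lebesgue_rV R d.

Definition weight k P x : R :=
  \prod_j fine_tent (P j) (scaled_coord r (side r k) x j).

Lemma weight_ge0 k P x : 0 <= weight k P x.
Proof.
apply: prodr_ge0 => j _.
by have /andP[] := tent_itv (scaled_coord r (side r k) x j - (P j)%:R).
Qed.

Lemma weight_norm k P x : `|weight k P x| <= 2 ^+ d.
Proof.
rewrite ger0_norm ?weight_ge0//.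
apply: (@le_trans _ _ (\prod_(j < d) (2 : R))); last by rewrite prodr_const card_ord.
by apply: ler_prod => j _; exact: tent_itv.
Qed.

Lemma measurable_tent_affine (l b : R) :
  measurable_fun setT ((fun t => tent ((t + r) / l - b)) : measurableTypeR R -> R).
Proof.
apply: (@continuous_measurable_fun R (fun t => tent ((t + r) / l - b))) => t.
apply: (continuous_comp (f := fun t => (t + r) / l - b) (g := tent));
  last exact: continuous_tent.
apply: cvgB; last exact: cvg_cst.
by apply: cvgM; [apply: cvgD; [exact: cvg_id|exact: cvg_cst]|exact: cvg_cst].
Qed.

Lemma measurable_weight k P : measurable_fun setT (weight k P).
Proof.
apply: (measurable_tensor_rV (phi := fun j t => tent ((t + r) / side r k - (P j)%:R))).
by move=> j; exact: measurable_tent_affine.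
Qed.

Lemma weight_outside k P x : ~ cell r k P x -> weight k P x = 0.
Proof.
move=> /existsNP[j xj]; rewrite /weight (bigD1 j)//= /fine_tent /scaled_coord.
have s0 := side_gt0 r0 k; set t := _ - _.
have tE : x ord0 j = - r + side r k * (P j)%:R + side r k * t.
  by rewrite /t; field; rewrite side_neq0.
suff -> : tent t = 0 by rewrite mul0r.
have [t0|t0] := leP t 0; first exact: tent_le0.
have [t1|t1] := leP 1 t; first exact: tent_ge1.
exfalso; apply: xj; rewrite /= tE; have /= := cell_side r k P j.
have := ler_piMr (ltW s0) (ltW t1); have := mulr_ge0 (ltW s0) (ltW t0).
by move=> *; apply/andP; split; lra.
Qed.

Lemma integral_tent_affine (l : R) (m : nat) : 0 < l ->
  (\int[@lebesgue_measure R]_t (tent ((t + r) / l - m%:R))%:E = l%:E)%E.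
Proof.
move=> l0; pose a := - r + l * m%:R; pose b := - r + l * m.+1%:R.
have ba : b - a = l by rewrite /a /b -natr1; ring.
have ab : a < b by rewrite -subr_gt0 ba.
have yE t : (t + r) / l - m%:R = (t - a) / l by rewrite /a; field; rewrite gt_eqF.
transitivity (\int[@lebesgue_measure R]_(t in `[a, b]) (tent ((t - a) / l))%:E)%E.
  rewrite [RHS]integral_mkcond; apply: eq_integral => t _; rewrite patchE yE.
  case: ifPn => // /negP; rewrite inE /= in_itv/= => /negP; rewrite negb_and -!ltNge.
  case/orP => h; [rewrite tent_le0//|rewrite tent_ge1//].
    by rewrite pmulr_lle0 ?invr_gt0// subr_le0 ltW.
  by rewrite ler_pdivlMr// mul1r -ba lerB// ltW.
pose F t := l * ramp (l^-1 * t + - (a / l)).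
have tE t : (t - a) / l = l^-1 * t + - (a / l) by ring.
have dF (t : R) : is_derive t 1 F (tent ((t - a) / l)).
  apply: (is_derive_eq (f' := l * (l^-1 * tent ((t - a) / l)))); last first.
    by rewrite mulrA mulfV ?mul1r// gt_eqF.
  apply: (@is_deriveZ _ _ _ (fun t => ramp (l^-1 * t + - (a / l))) l).
  by apply: is_derive_affine; rewrite -tE; exact: is_derive_ramp.
have cF : continuous F.
  by move=> t; apply/differentiable_continuous/derivable1_diffP; have [] := dF t.
rewrite (@continuous_FTC2 _ (fun t => tent ((t - a) / l)) F _ _ ab).
- rewrite -EFinB /F -!tE subrr mul0r ba divff ?gt_eqF//.
  by rewrite ramp_ge1// ramp_le0// mulr0 subr0 mulr1.
- apply: continuous_subspaceT => t.
  apply: (continuous_comp (f := fun t => (t - a) / l) (g := tent)); last exact: continuous_tent.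
  by apply: cvgM; [apply: cvgB; [exact: cvg_id|exact: cvg_cst]|exact: cvg_cst].
- split; first by move=> t _; have [] := dF t.
  + by apply: cvg_at_right_filter; exact: cF.
  + by apply: cvg_at_left_filter; exact: cF.
- by move=> t _; rewrite derive1E; have [] := dF t.
Qed.

Lemma integral_weight k P : \int[mu]_x weight k P x = side r k ^+ d.
Proof.
rewrite /Rintegral /weight.
rewrite (integral_tensor_rV (phi := fun j t => tent ((t + r) / side r k - (P j)%:R))).
- under eq_bigr do rewrite integral_tent_affine ?side_gt0//.
  by rewrite prodEFin/= prodr_const card_ord.
- by move=> j; exact: measurable_tent_affine.
- by move=> j t; case/andP: (tent_itv ((t + r) / side r k - (P j)%:R)).
Qed.

Lemma integrable_mul_weight f k P : mu.-integrable setT (EFin \o f) ->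
  mu.-integrable setT (EFin \o (fun x => f x * weight k P x)).
Proof.
move=> fi; apply: integrable_mul_bounded fi _ (weight_norm k P).
exact: measurable_weight.
Qed.

Definition avg f k P : R := (side r k ^+ d)^-1 * \int[mu]_x (f x * weight k P x).

Definition approx f k : 'rV[R]_d -> R := step r k (avg f k).

Lemma avgB f g k P : mu.-integrable setT (EFin \o f) ->
  mu.-integrable setT (EFin \o g) ->
  avg (fun x => f x - g x) k P = avg f k P - avg g k P.
Proof.
move=> fi gi; rewrite /avg -mulrBr -RintegralB//; try exact: integrable_mul_weight.
by congr (_ * _); apply: eq_Rintegral => x _; rewrite mulrBl.
Qed.

Lemma avgZ c f k P : mu.-integrable setT (EFin \o f) ->
  avg (fun x => c * f x) k P = c * avg f k P.
Proof.
move=> fi; rewrite /avg mulrCA; congr (_ * _).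
rewrite -RintegralZl//; last exact: integrable_mul_weight.
by apply: eq_Rintegral => x _; rewrite mulrA.
Qed.

Lemma approxB f g k x : mu.-integrable setT (EFin \o f) ->
  mu.-integrable setT (EFin \o g) ->
  approx (fun x => f x - g x) k x = approx f k x - approx g k x.
Proof.
move=> fi gi; rewrite /approx /step -sumrB; apply: eq_bigr => p _.
by rewrite avgB// mulrBl.
Qed.

Lemma approxZ c f k x : mu.-integrable setT (EFin \o f) ->
  approx (fun x => c * f x) k x = c * approx f k x.
Proof.
move=> fi; rewrite /approx /step mulr_sumr; apply: eq_bigr => p _.
by rewrite avgZ// mulrA.
Qed.

Lemma sum_weight_le k x :
  \sum_(p : {ffun 'I_d -> 'I_(2 ^ k)}) weight k (fun j => p j) x <= 32 ^+ d.
Proof.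
pose a (j : 'I_d) (m : 'I_(2 ^ k)) := fine_tent m (scaled_coord r (side r k) x j).
apply: le_trans (tensor_bound (A := a) (fun j => (lip_fine_tent _).1 _)).
by apply: ler_sum => p _; exact: ler_norm.
Qed.

(** The weights of one level add up to at most [32 ^ d] at every point. This bounds the operators
    [approx] on L^1 uniformly in the level, which the passage from dense functions to all functions
    rests on. *)
Lemma sum_avg_le f k : mu.-integrable setT (EFin \o f) ->
  side r k ^+ d * \sum_(p : {ffun 'I_d -> 'I_(2 ^ k)}) `|avg f k (fun j => p j)|
    <= 32 ^+ d * \int[mu]_x `|f x|.
Proof.
move=> fi; have nfi := integrable_normr fi.
have sd : 0 < side r k ^+ d by rewrite exprn_gt0 ?side_gt0.
rewrite mulr_sumr.
apply: (@le_trans _ _ (\sum_(p : {ffun 'I_d -> 'I_(2 ^ k)})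
    \int[mu]_x (`|f x| * weight k (fun j => p j) x))).
  apply: ler_sum => p _; rewrite /avg normrM ger0_norm ?invr_ge0 ?(ltW sd)//.
  rewrite mulrA mulfV ?gt_eqF// mul1r.
  apply: le_trans (le_normr_Rintegral _ _) _ => //; first exact: integrable_mul_weight.
  rewrite le_eqVlt; apply/orP; left; apply/eqP/eq_Rintegral => x _.
  by rewrite normrM (ger0_norm (weight_ge0 _ _ _)).
rewrite -Rintegral_sum; last by move=> p; exact: integrable_mul_weight.
rewrite -RintegralZl//; apply: le_Rintegral => //.
- by apply: integrable_sumr => p; exact: integrable_mul_weight.
- exact: integrable_scale.
- move=> x _; rewrite -mulr_sumr mulrC ler_wpM2r//; exact: sum_weight_le.
Qed.

Lemma approx_L1 f k : mu.-integrable setT (EFin \o f) ->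
  \int[mu]_x `|approx f k x| <= 32 ^+ d * \int[mu]_x `|f x|.
Proof. by move=> fi; apply: le_trans (sum_avg_le k fi); exact: step_L1. Qed.

Lemma integrable_approx f k : mu.-integrable setT (EFin \o approx f k).
Proof. exact: integrable_step. Qed.

Lemma integrable_weight k P : mu.-integrable setT (EFin \o weight k P).
Proof.
rewrite (_ : weight k P = fun x => \1_(cell r k P) x * weight k P x).
  apply: integrable_mul_bounded (integrable_indic_cell r0 k P) _ (weight_norm k P).
  exact: measurable_weight.
apply/funext => x; have [xP|xP] := pselect (cell r k P x).
  by rewrite indicE mem_set// mul1r.
by rewrite weight_outside// mulr0.
Qed.

(** The weight vanishes off the cell and is normalised by its integral. This exactness gives
    pointwise convergence wherever a function is locally constant. *)
Lemma avg_cst_on_cell f k P c : (forall x, cell r k P x -> f x = c) -> avg f k P = c.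
Proof.
move=> fc; rewrite /avg (_ : Rintegral _ _ _ = c * side r k ^+ d).
  by rewrite mulrC mulfK// expf_neq0// side_neq0.
rewrite -(integral_weight k P) -RintegralZl//; last exact: integrable_weight.
apply: eq_Rintegral => x _; have [xP|xP] := pselect (cell r k P x).
  by rewrite fc.
by rewrite weight_outside// !mulr0.
Qed.

Lemma avg_norm_le f k P c : mu.-integrable setT (EFin \o f) -> 0 <= c ->
  (forall x, `|f x| <= c) -> `|avg f k P| <= c.
Proof.
move=> fi c0 fc.
have sd : 0 < side r k ^+ d by rewrite exprn_gt0 ?side_gt0.
rewrite /avg normrM ger0_norm ?invr_ge0 ?(ltW sd)// mulrC ler_pdivrMr//.
apply: le_trans (le_normr_Rintegral _ _) _ => //; first exact: integrable_mul_weight.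
rewrite -(integral_weight k P) -RintegralZl//; last exact: integrable_weight.
apply: le_Rintegral => //.
- by apply: integrable_normr; exact: integrable_mul_weight.
- by apply: integrable_scale; exact: integrable_weight.
- by move=> x _; rewrite normrM (ger0_norm (weight_ge0 _ _ _)) ler_wpM2r ?weight_ge0.
Qed.

Lemma avg_eq_cube f g k (P : 'I_d -> nat) : (forall j, (P j < 2 ^ k)%N) ->
  (forall x, cube r x -> f x = g x) -> avg f k P = avg g k P.
Proof.
move=> Pk fg; congr (_ * _); apply: eq_Rintegral => x _.
have [xP|xP] := pselect (cell r k P x).
  by rewrite fg//; exact: (cell_sub_cube r0 Pk).
by rewrite weight_outside// !mulr0.
Qed.

End averages.

(** * Convergence of the weighted averages *)

Section convergence.
Context {R : realType}.
Variables (d : nat) (r : R).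
Hypothesis r0 : 0 < r.
Implicit Types (k : nat) (P : 'I_d -> nat) (x : 'rV[R]_d) (f g : 'rV[R]_d -> R).
Let mu := @lebesgue_rV R d.

Definition err f k : R := \int[mu]_x `|f x - approx r f k x|.

Definition approximable f :=
  mu.-integrable setT (EFin \o f) /\ err f @ \oo --> 0.

Lemma err_ge0 f k : 0 <= err f k.
Proof. exact: Rintegral_ge0. Qed.

Lemma integrable_sub f g : mu.-integrable setT (EFin \o f) ->
  mu.-integrable setT (EFin \o g) ->
  mu.-integrable setT (EFin \o (fun x => f x - g x)).
Proof. by move=> fi gi; exact: (integrableB measurableT fi gi). Qed.

Lemma integrable_add f g : mu.-integrable setT (EFin \o f) ->
  mu.-integrable setT (EFin \o g) ->
  mu.-integrable setT (EFin \o (fun x => f x + g x)).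
Proof. by move=> fi gi; exact: (integrableD measurableT fi gi). Qed.

Lemma L1_dist_le f g h : mu.-integrable setT (EFin \o f) ->
  mu.-integrable setT (EFin \o g) -> mu.-integrable setT (EFin \o h) ->
  (forall x, `|f x| <= `|g x| + `|h x|) ->
  \int[mu]_x `|f x| <= \int[mu]_x `|g x| + \int[mu]_x `|h x|.
Proof.
move=> fi gi hi fgh; rewrite -RintegralD//; try exact: integrable_normr.
apply: le_Rintegral => //; first exact: integrable_normr.
by apply: integrable_add; exact: integrable_normr.
Qed.

Lemma integrable_err f k : mu.-integrable setT (EFin \o f) ->
  mu.-integrable setT (EFin \o (fun x => f x - approx r f k x)).
Proof. by move=> fi; apply: integrable_sub => //; exact: integrable_approx. Qed.

Lemma err_le f g k : mu.-integrable setT (EFin \o f) ->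
  mu.-integrable setT (EFin \o g) ->
  err f k <= (1 + 32 ^+ d) * \int[mu]_x `|f x - g x| + err g k.
Proof.
move=> fi gi; have fgi := integrable_sub fi gi.
have H : err f k <= err (fun x => f x - g x) k + err g k.
  apply: L1_dist_le; try exact: integrable_err.
  move=> x; rewrite approxB//; apply: le_trans (ler_normD _ _).
  by rewrite le_eqVlt; apply/orP; left; apply/eqP; congr `| _ |; ring.
apply: le_trans H _; rewrite lerD2r mulrDl mul1r.
apply: (@le_trans _ _ (\int[mu]_x `|f x - g x| +
    \int[mu]_x `|approx r (fun x => f x - g x) k x|)).
  apply: L1_dist_le => //; [exact: integrable_err|exact: integrable_approx|].
  by move=> x; exact: ler_normB.
by rewrite lerD2l; exact: approx_L1.
Qed.

(** By [err_le] the error of [f] exceeds that of [g] by at most [1 + 32 ^ d] times their distance,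
    at all levels at once. *)
Lemma approximable_closed f : mu.-integrable setT (EFin \o f) ->
  (forall e, 0 < e -> exists2 g, approximable g & \int[mu]_x `|f x - g x| <= e) ->
  approximable f.
Proof.
move=> fi H; split=> //; apply/cvgr0Pnorm_lt => e e0.
have C0 : 0 < 1 + 32 ^+ d :> R by rewrite ltr_pwDl// exprn_ge0.
have [g [gi gK] fg] := H (e / 2 / (1 + 32 ^+ d)) (divr_gt0 (divr_gt0 e0 (ltr0n _ 2)) C0).
have ge : \forall k \near \oo, `|err g k| < e / 2.
  by move/cvgr0Pnorm_lt : gK; apply; rewrite divr_gt0.
near=> k.
have gk : err g k < e / 2.
  by apply: le_lt_trans (ler_norm _) _; near: k.
rewrite ger0_norm; last exact: err_ge0.
apply: le_lt_trans (err_le k fi gi) _; rewrite [ltRHS]splitr.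
apply: ler_ltD => //; apply: le_trans (ler_wpM2l (ltW C0) fg) _.
by rewrite mulrC divfK// gt_eqF.
Unshelve. all: by end_near. Qed.

Lemma approximableZ c f : approximable f -> approximable (fun x => c * f x).
Proof.
move=> [fi fK]; split; first exact: integrable_scale.
rewrite (_ : err _ = fun k => `|c| * err f k).
  by rewrite -(mulr0 `|c|); apply: cvgM fK; exact: cvg_cst.
apply/funext => k; rewrite [in RHS]/err -RintegralZl//; last first.
  by apply: integrable_normr; exact: integrable_err.
by apply: eq_Rintegral => x _; rewrite approxZ// -mulrBr normrM.
Qed.

Lemma approximableB f g : approximable f -> approximable g ->
  approximable (fun x => f x - g x).
Proof.
move=> [fi fK] [gi gK]; split; first exact: integrable_sub.
apply: (@squeeze_cvgr _ _ _ _ (cst 0) (fun k => err f k + err g k)).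
- near=> k; apply/andP; split; first exact: err_ge0.
  apply: L1_dist_le; try exact: integrable_err; first exact/integrable_err/integrable_sub.
  move=> x; rewrite approxB//; apply: le_trans (ler_normB _ _).
  by rewrite le_eqVlt; apply/orP; left; apply/eqP; congr `| _ |; ring.
- exact: cvg_cst.
- by have := cvgD fK gK; rewrite addr0; apply.
Unshelve. all: by end_near. Qed.

Lemma approximable0 : approximable (fun=> 0).
Proof.
have i0 : mu.-integrable setT (EFin \o (fun=> 0 : R)) by exact: integrable0.
split=> //; rewrite (_ : err _ = cst 0); first exact: cvg_cst.
apply/funext => k; rewrite /err /Rintegral integral0_eq// => x _.
have -> : (fun=> 0 : R) = (fun x : 'rV[R]_d => 0 * (fun=> 0) x).
  by apply/funext => y; rewrite mul0r.
by rewrite approxZ// !mul0r subr0 normr0.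
Qed.

Lemma approximable_sum (I : Type) (s : seq I) (F : I -> 'rV[R]_d -> R) :
  (forall i, approximable (F i)) -> approximable (fun x => \sum_(i <- s) F i x).
Proof.
move=> HF; elim: s => [|i s IH].
  rewrite (_ : (fun x => _) = fun=> 0); first exact: approximable0.
  by apply/funext => x; rewrite big_nil.
rewrite (_ : (fun x => _) = fun x => F i x - (-1) * (\sum_(i <- s) F i x)).
  exact: (approximableB (HF i) (approximableZ (-1) IH)).
by apply/funext => x; rewrite big_cons mulN1r opprK.
Qed.

Lemma L1_dominated_cvg (f_ : nat -> 'rV[R]_d -> R) f g :
  (forall n, measurable_fun setT (f_ n)) -> measurable_fun setT f ->
  {ae mu, forall x, f_ ^~ x @ \oo --> f x} ->
  mu.-integrable setT (EFin \o g) ->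
  {ae mu, forall x, forall n, `|f_ n x| <= g x} ->
  (fun n => \int[mu]_x `|f x - f_ n x|) @ \oo --> 0.
Proof.
move=> mf_ mf f_f gi f_g.
have [] := @dominated_convergence _ _ _ mu setT measurableT
  (fun n => EFin \o f_ n) (EFin \o f) (EFin \o g).
- by move=> n; exact/measurable_EFinP.
- exact/measurable_EFinP.
- by apply: filterS f_f => x fx _; apply: cvg_EFin => //; exact: nearW.
- exact: gi.
- by apply: filterS f_g => x fx n _; rewrite /= lee_fin.
move=> _ H _.
suff -> : (fun n => \int[mu]_x `|f x - f_ n x|) =
    fine \o (fun n => \int[mu]_x `|(f_ n x)%:E - (f x)%:E|)%E by exact: fine_cvg H.
apply/funext => n /=; congr fine; apply: eq_integral => x _.
by rewrite /= distrC.
Qed.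

Lemma measurable_cube : measurable (@cube R d r).
Proof. exact: measurable_box. Qed.

Lemma lebesgue_cube_fin : (@lebesgue_rV R d (cube r) < +oo)%E.
Proof.
rewrite cubeE lebesgue_rV_closed_box ?ltry// => j.
by rewrite lerNl; have := r0; lra.
Qed.

Lemma integrable_indic_cubeI (A : set 'rV[R]_d) : measurable A ->
  mu.-integrable setT (EFin \o \1_(A `&` cube r)).
Proof.
move=> mA; apply: integrable_indic_fin.
  by apply: measurableI => //; exact: measurable_cube.
apply: le_lt_trans lebesgue_cube_fin.
by apply: (le_measure mu); rewrite ?inE//; [apply: measurableI => //|];
  exact: measurable_cube.
Qed.

Lemma side_small (e : R) : 0 < e -> \forall k \near \oo, side r k <= e.
Proof.
move=> e0; exists (Num.truncn (2 * r / e)).+1 => // k /= Nk.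
have : 2 * r / e <= 2 ^+ k.
  apply: ltW; apply: lt_le_trans (truncnS_gt _) _.
  by rewrite -natrX ler_nat (leq_trans Nk)// ltnW// ltn_expl.
by rewrite /side !ler_pdivrMr ?exprn_gt0// (mulrC e).
Qed.

(** Near almost every point the indicator is constant, so once the cells are small the average
    equals its value. Dominated convergence, under the indicator of the cube, concludes. *)
Lemma approximable_indic (A : set 'rV[R]_d) : measurable A ->
  {ae mu, forall x, exists2 e, 0 < e &
    forall y : 'rV[R]_d, (forall j, `|y ord0 j - x ord0 j| <= e) -> (A y <-> A x)} ->
  approximable \1_(A `&` cube r).
Proof.
move=> mA Aloc; set f := \1__; have fi : mu.-integrable setT (EFin \o f).
  exact: integrable_indic_cubeI.
have mf : measurable_fun setT f by have /measurable_int/measurable_EFinP := fi.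
have f1 x : `|f x| <= 1 by rewrite /f indicE; case: (_ \in _); rewrite ?normr1// normr0.
split=> //.
apply: (@L1_dominated_cvg (approx r f) f \1_(setT `&` cube r)) => //.
- by move=> n; have /measurable_int/measurable_EFinP := integrable_approx r0 f n.
- apply: filterS2 Aloc (ae_generic d r) => x [e e0 Ae] gx.
  have [Qx|Qx] := pselect (cube r x); last first.
    rewrite (_ : (fun n => _) = cst 0).
      by rewrite /f indicE memNset; [exact: cvg_cst|move=> []].
    by apply/funext => k; rewrite /approx step_outside.
  apply: cvg_near_cst; apply: filterS (side_small e0) => k ke.
  have [p xp] := generic_cell_ex r0 k gx Qx.
  rewrite /approx (step_generic r0 _ gx xp); apply: avg_cst_on_cell => // y yp.
  have Qy : cube r y by apply: (cell_sub_cube r0 _ yp) => j; exact: ltn_ord.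
  have Ayx : A y <-> A x.
    apply: Ae => j; apply: le_trans ke; have := cell_side r k (fun j => p j) j.
    have /andP[] := xp j; have /andP[] := yp j => /= *.
    by rewrite ler_norml; apply/andP; split; lra.
  rewrite /f !indicE; congr (nat_of_bool _)%:R; apply/idP/idP; rewrite !inE.
    by move=> [/Ayx Ax _].
  by move=> [/Ayx Ay _].
- exact: integrable_indic_cubeI.
- apply: filterS (ae_generic d r) => x gx n; rewrite setTI.
  have [Qx|Qx] := pselect (cube r x); last first.
    by rewrite /approx step_outside// normr0 indicE.
  have [p xp] := generic_cell_ex r0 n gx Qx.
  rewrite /approx (step_generic r0 _ gx xp) indicE mem_set//.
  exact: avg_norm_le.
Qed.

End convergence.

Import HBSimple.

(** * From orthants to integrable functions *)

Section density.
Context {R : realType}.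
Variables (d : nat) (r : R).
Hypothesis r0 : 0 < r.
Let mu := @lebesgue_rV R d.

(** Infinite bounds are allowed, so that open half-spaces, which generate the sigma-algebra, are
    included. Intersections take minima of the bounds, which makes a pi-system. *)
Definition orthant (c : 'I_d -> \bar R) : set 'rV[R]_d :=
  [set x | forall j, ((x ord0 j)%:E < c j)%E].

Lemma measurable_orthant c : measurable (orthant c).
Proof.
apply: (measurable_pi (A := fun j => [set t : R | (t%:E < c j)%E])) => j.
case: (c j) => [v| |].
- rewrite (_ : [set t | _] = `]-oo, v[%classic); first exact: measurable_itv.
  by apply/seteqP; split=> t /=; rewrite in_itv/= lte_fin.
- rewrite (_ : [set t | _] = setT); first exact: measurableT.
  by apply/seteqP; split=> t //= _; rewrite ltry.
- rewrite (_ : [set t | _] = set0); first exact: measurable0.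
  by apply/seteqP; split=> t //=; rewrite ltNge leNye.
Qed.

Lemma setI_orthant : setI_closed (range orthant).
Proof.
move=> _ _ [c _ <-] [c' _ <-]; exists (fun j => Order.min (c j) (c' j)) => //.
apply/seteqP; split=> x /=.
  by move=> h; split=> j; have := h j; rewrite lt_min => /andP[].
by move=> [h h'] j; rewrite lt_min h h'.
Qed.

Lemma orthant_locally_cst c : {ae mu, forall x : 'rV[R]_d, exists2 e, 0 < e &
    forall y : 'rV[R]_d, (forall j, `|y ord0 j - x ord0 j| <= e) ->
      (orthant c y <-> orthant c x)}.
Proof.
(* For infinite [c j] the value [fine (c j)] is 0: this discards one more null hyperplane and keeps
   the radius [e] below positive. *)
have : {ae mu, forall x : 'rV[R]_d, forall j, x ord0 j != fine (c j)}.
  by apply: filter_forall => j; exact: ae_coord_neq.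
apply: filterS => x hx.
pose e := \big[Order.min/1]_j (`|x ord0 j - fine (c j)| / 2).
exists e.
  by apply/bigmin_gtP; split=> // j _; rewrite divr_gt0// normr_gt0 subr_eq0.
move=> y yx.
have H j : ((y ord0 j)%:E < c j)%E = ((x ord0 j)%:E < c j)%E.
  have ej : e <= `|x ord0 j - fine (c j)| / 2 by exact: bigmin_le_cond.
  have := le_trans (yx j) ej; have := hx j.
  case: (c j) => [v /=|_ _|_ _]; [|by rewrite !ltry|by rewrite !ltNge !leNye].
  rewrite !lte_fin ler_norml => xv /andP[h1 h2].
  have [xltv|] := ltP (x ord0 j) v.
    by move: h1 h2; rewrite ltr0_norm ?subr_lt0// => *; lra.
  rewrite le_eqVlt eq_sym (negPf xv)/= => vx.
  by move: h1 h2; rewrite gtr0_norm ?subr_gt0// => *; apply/negbTE; rewrite -leNgt; lra.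
by split=> h j; have := h j; rewrite H.
Qed.

Lemma measurable_orthants (A : set 'rV[R]_d) : measurable A -> <<s range orthant >> A.
Proof.
apply: smallest_sub; first exact: smallest_sigma_algebra.
move=> B; rewrite -bigcup_seq => -[j _] /= [C mC <-]; rewrite setTI.
have : @measurable_fun _ _ (g_sigma_algebraType (range orthant)) (measurableTypeR R) setT
    (fun x : 'rV[R]_d => x ord0 j).
  apply: (measurability _ (RGenInftyO.measurableE R)) => _ [_ [t ->] <-].
  rewrite setTI; apply: sub_sigma_algebra.
  exists (fun i => if i == j then t%:E else +oo%E) => //.
  apply/seteqP; split=> x /=; rewrite in_itv/=.
    by move=> /(_ j); rewrite eqxx lte_fin.
  by move=> xt i; case: eqVneq => [->|_]; rewrite ?lte_fin// ltry.
by move=> /(_ measurableT C mC); rewrite setTI.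
Qed.

(** Pi-lambda theorem: the good sets contain the orthants, and are stable under proper differences
    by linearity and under increasing unions by closedness in L^1. *)
Lemma approximable_set (A : set 'rV[R]_d) : measurable A ->
  approximable r (\1_(A `&` cube r) : 'rV[R]_d -> R).
Proof.
move=> mA.
pose H := [set A : set 'rV[R]_d | measurable A /\
  approximable r (\1_(A `&` cube r) : 'rV[R]_d -> R)].
suff : H A by case.
have HS : lambda_system setT H.
  split.
  - by move=> B _ x _.
  - split; first exact: measurableT.
    apply: (approximable_indic r0 measurableT); by apply: aeW => x; exists 1.
  - move=> B C CB [mB HB] [mC HC]; split; first exact: measurableD.
    rewrite (_ : \1__ = fun x => \1_(B `&` cube r) x - \1_(C `&` cube r) x).
      exact: (approximableB r0 HB HC).
    apply/funext => x; rewrite !indicE setDE !in_setI in_setC.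
    have [xC|] := boolP (x \in C); last by rewrite andbT subr0.
    by rewrite (mem_set (CB _ (set_mem xC))) andbF/= subrr.
  - move=> F ndF HF; have mF n : measurable (F n) by case: (HF n).
    have mU : measurable (\bigcup_n F n) by exact: bigcup_measurable.
    split; first exact: mU.
    apply: (approximable_closed r0); first exact: (integrable_indic_cubeI r0 mU).
    have D : (fun n => \int[mu]_x `|\1_(\bigcup_n F n `&` cube r) x -
        \1_(F n `&` cube r) x|) @ \oo --> (0 : R).
      have mI (B : set 'rV[R]_d) : measurable B ->
          measurable_fun setT (\1_(B `&` cube r) : 'rV[R]_d -> R).
        by move=> mB; have /measurable_int/measurable_EFinP := integrable_indic_cubeI r0 mB.
      apply: (@L1_dominated_cvg _ _ _ _ (\1_(setT `&` cube r))).
      + by move=> n; exact: mI.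
      + exact: mI.
      + apply: aeW => x; apply: cvg_near_cst.
        have [[n _ Fnx]|nU] := pselect ((\bigcup_n F n) x).
          exists n => // m /= nm; rewrite !indicE !in_setI.
          rewrite (mem_set (_ : (\bigcup_n F n) x)); last by exists n.
          by rewrite (mem_set (_ : F m x))//; have /subsetPset := ndF _ _ nm; exact.
        apply: nearW => m; rewrite !indicE !in_setI (memNset nU) (memNset (_ : ~ F m x))//.
        by move=> Fmx; apply: nU; exists m.
      + exact: integrable_indic_cubeI.
      + apply: aeW => x n; rewrite !indicE !in_setI ger0_norm//.
        by rewrite ler_nat in_setT/=; case: (_ \in cube r); case: (_ \in F n).
    move=> e e0; move/cvgr0Pnorm_lt : D => /(_ e e0) [n _ /(_ n (leqnn n)) ne].
    exists (\1_(F n `&` cube r)); first by case: (HF n).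
    by apply: ltW; apply: le_lt_trans (ler_norm _) ne.
have GH : range orthant `<=` H.
  move=> _ [c _ <-]; split; first exact: measurable_orthant.
  by apply: (approximable_indic r0); [exact: measurable_orthant|exact: orthant_locally_cst].
apply: (lambda_system_subset setI_orthant HS GH); last exact: measurable_orthants.
by move=> X _ x _.
Qed.

(** Simple functions are dense in L^1. Cut to the cube they are combinations of indicators already
    treated, and the cut does not increase the distance to [u], which vanishes outside. *)
Lemma approximable_integrable (u : 'rV[R]_d -> R) :
  mu.-integrable setT (EFin \o u) -> (forall x, ~ cube r x -> u x = 0) ->
  approximable r u.
Proof.
move=> ui u0; apply: (approximable_closed r0 ui) => e e0.
have [g [gi _ gu]] := approximation_sfun_integrable measurableT ui.
have gR : (fun n => \int[mu]_x `|u x - g n x|) @ \oo --> (0 : R) by exact: fine_cvg gu.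
move/cvgr0Pnorm_lt : gR => /(_ e e0) [n _ /(_ n (leqnn n)) ne].
pose G := g n; pose s : seq R := finmap.enum_fset (fset_set (range G)).
have GE x : G x * \1_(cube r) x =
    \sum_(y <- s) y * \1_(G @^-1` [set y] `&` cube r) x.
  rewrite {1}(fimfunE G x) fsbig_finite//= mulr_suml; apply: eq_bigr => y _.
  by rewrite -mulrA !indicE in_setI -natrM mulnb.
exists (fun x => G x * \1_(cube r) x).
  rewrite (_ : (fun x => _) = fun x => \sum_(y <- s) y * \1_(G @^-1` [set y] `&` cube r) x).
    apply: (approximable_sum r0) => y; apply: (approximableZ r0); apply: approximable_set.
    by rewrite -[X in measurable X]setTI; exact: measurable_funP.
  exact/funext/GE.
apply: (@le_trans _ _ (\int[mu]_x `|u x - G x|)).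
  apply: le_Rintegral => //.
  - apply: integrable_normr; apply: integrable_sub => //.
    apply: (@integrable_mul_bounded _ _ _ _ _ _ 1) => //; first exact: gi.
      by apply: measurable_indic; exact: measurable_cube.
    by move=> x; rewrite indicE; case: (_ \in _); rewrite ?normr1// normr0.
  - by apply: integrable_normr; apply: integrable_sub => //; exact: gi.
  - move=> x _; have [Qx|Qx] := pselect (cube r x).
      by rewrite indicE mem_set// mulr1.
    by rewrite indicE memNset// mulr0 u0// subr0 normr0.
by apply: ltW; apply: le_lt_trans (ler_norm _) ne.
Qed.

End density.

(** * Decomposition *)

Section coefficients.
Context {R : realType}.
Variables (n : nat) (r alpha v : R) (u : 'rV[R]_n.+1 -> R).
Hypothesis r0 : 0 < r.
Hypothesis alpha01 : 0 <= alpha < 1.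
Hypothesis ui : (@lebesgue_rV R n.+1).-integrable setT (EFin \o u).
Hypothesis uv : Valpha alpha u = v%:E.
Let mu := @lebesgue_rV R n.+1.

(** The bound 4 covers fine tents (2), coarse tents (1) and their differences (3). *)
Definition tame (f : R -> R) := continuous f /\ forall t, `|f t| <= 4.

Lemma integrable_mul_prod k (B : 'I_n.+1 -> R -> R) : (forall j, tame (B j)) ->
  mu.-integrable setT
    (EFin \o (fun x => u x * \prod_j B j (scaled_coord r (side r k) x j))).
Proof.
move=> Btame; apply: (@integrable_mul_bounded _ _ _ _ _ _ (4 ^+ n.+1)) => //.
  apply: (measurable_tensor_rV (phi := fun j t => B j ((t + r) / side r k))) => j.
  apply: (@continuous_measurable_fun R (fun t => B j ((t + r) / side r k))) => t.
  apply: (continuous_comp (f := fun t => (t + r) / side r k) (g := B j)).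
    by apply: cvgM; [apply: cvgD; [exact: cvg_id|exact: cvg_cst]|exact: cvg_cst].
  exact: (Btame j).1.
move=> x; rewrite normr_prod -[X in _ ^+ X]card_ord -prodr_const.
by apply: ler_prod => j _; rewrite normr_ge0 (Btame j).2.
Qed.

Definition test_bound k : R := 2 * n.+1%:R * 32 ^+ n.+1 * side r k `^ (1 - alpha).

Lemma test_bound_gt0 k : 0 < test_bound k.
Proof. by rewrite /test_bound !mulr_gt0 ?exprn_gt0 ?powR_gt0 ?side_gt0. Qed.

(** The signed sum over all cubes is one integral of [u] against one partial derivative, so [Valpha]
    is invoked once for the whole level and not once per cube. *)
Lemma tensor_test_le k N (A : 'I_n.+1 -> 'I_N -> R -> R)
    (s : {ffun 'I_n.+1 -> 'I_N} -> R) (i : 'I_n.+1) (a : 'I_N -> R -> R) :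
  (forall j, lip_family (A j) 32) -> (forall p, `|s p| <= 1) ->
  (forall m (t : R), is_derive t 1 (A i m) (a m t)) ->
  (forall j m, tame ((if j == i then a else A j) m)) ->
  `|\sum_p s p * \int[mu]_x (u x *
     \prod_j (if j == i then a else A j) (p j) (scaled_coord r (side r k) x j))|
  <= v * test_bound k.
Proof.
move=> Alip s1 Aa Btame.
pose B j := if j == i then a else A j.
pose h x := side r k * tensor A s r (side r k) x.
have l0 := side_gt0 r0 k.
have Dh x : 'D_(basis_rV i) h x = tensor B s r (side r k) x.
  by rewrite derive_tensor// gt_eqF.
have Ii p := integrable_mul_prod k (fun j => Btame j (p j)).
have E : (fun x => u x * 'D_(basis_rV i) h x) = fun x =>
    \sum_p s p * (u x * \prod_j B j (p j) (scaled_coord r (side r k) x j)).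
  by apply/funext => x; rewrite Dh mulr_sumr; apply: eq_bigr => p _; rewrite mulrCA.
have Ih : mu.-integrable setT (EFin \o (fun x => u x * 'D_(basis_rV i) h x)).
  by rewrite E; apply: integrable_sumr => p; exact: integrable_scale (Ii p).
(* Exponent 1 will show that [h] is an admissible test, exponent [alpha] will give the bound. *)
have hold (b : R) : 0 <= b <= 1 -> (Lip b h <=
    (2 * n.+1%:R * 32 ^+ n.+1 * side r k `^ (1 - b))%:E)%E.
  by move=> b01; apply: Lip_le => x y; exact: tensor_holder.
have := @Valpha_partial R n alpha u h i (test_bound k) (test_bound_gt0 k) _ _ Ih.
rewrite uv -EFinM lee_fin.
rewrite (_ : Rintegral _ _ _ = \sum_p s p * \int[mu]_x (u x *
    \prod_j B j (p j) (scaled_coord r (side r k) x j))).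
  apply.
    by apply: (le_lt_trans (hold 1 _)); rewrite ?ltry// ler01 lexx.
  by apply: hold; have /andP[-> /ltW] := alpha01.
rewrite E Rintegral_sum; last by move=> p; exact: integrable_scale (Ii p).
by apply: eq_bigr => p _; rewrite RintegralZl//; exact: Ii.
Qed.

Definition coefd k (P : 'I_n.+1 -> nat) : R :=
  avg r u k P - (if k is k'.+1 then avg r u k' (fun j => (P j)./2) else 0).

Lemma continuous_fine_tent m : continuous (fine_tent m : R -> R).
Proof.
move=> t; apply: (continuous_comp (f := fun t : R => t - m%:R) (g := tent)).
  by apply: cvgB; [exact: cvg_id|exact: cvg_cst].
exact: continuous_tent.
Qed.

Lemma continuous_coarse_tent m : continuous (coarse_tent m : R -> R).
Proof.
move=> t; apply: cvgM; last exact: cvg_cst.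
apply: (continuous_comp (f := half_coord m) (g := tent)); last exact: continuous_tent.
apply: cvgM; last exact: cvg_cst.
by apply: cvgB; [exact: cvg_id|exact: cvg_cst].
Qed.

Lemma coarse_tent_norm m (t : R) : `|coarse_tent m t| <= 1.
Proof.
rewrite /coarse_tent normrM [ `|2^-1| ]ger0_norm ?invr_ge0//.
by have := tent_norm (half_coord m t); lra.
Qed.

Lemma tame_fine_tent m : tame (fine_tent m).
Proof.
split; first exact: continuous_fine_tent.
by move=> t; have := tent_norm (t - m%:R); rewrite /fine_tent; lra.
Qed.

Lemma tame_coarse_tent m : tame (coarse_tent m).
Proof.
split; first exact: continuous_coarse_tent.
by move=> t; have := coarse_tent_norm m t; lra.
Qed.

Lemma tame_tentB m : tame (fun t => fine_tent m t - coarse_tent m t).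
Proof.
split=> [t|t].
  by apply: cvgB; [exact: continuous_fine_tent|exact: continuous_coarse_tent].
apply: le_trans (ler_normB _ _) _.
have := coarse_tent_norm m t; have := tent_norm (t - m%:R).
by rewrite -/(fine_tent m t); lra.
Qed.

(** The parent side is twice the child side, and the resulting power of 1/2 is spread as one factor
    1/2 per coarse tent. Averages of parent and child then carry the same normalisation. *)
Lemma coarse_weight k (P : 'I_n.+1 -> nat) x :
  (side r k ^+ n.+1)^-1 * weight r k (fun j => (P j)./2) x =
  (side r k.+1 ^+ n.+1)^-1 * \prod_j coarse_tent (P j) (scaled_coord r (side r k.+1) x j).
Proof.
have s0 : side r k.+1 != 0 by rewrite side_neq0.
rewrite /weight sideS exprMn invfM mulrC mulrA mulrC; congr (_ * _).
rewrite -exprVn -[X in _ ^+ X]card_ord -prodr_const -big_split/=.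
apply: eq_bigr => j _; rewrite /fine_tent /coarse_tent /half_coord /scaled_coord sideS.
congr (tent _ * _); rewrite -muln2 natrM; field.
by rewrite side_neq0.
Qed.

Lemma coefdS k P : side r k.+1 ^+ n.+1 * coefd k.+1 P =
  \sum_i \int[mu]_x (u x * \prod_j hybrid i
    (fun j => coarse_tent (P j) (scaled_coord r (side r k.+1) x j))
    (fun j => fine_tent (P j) (scaled_coord r (side r k.+1) x j) -
              coarse_tent (P j) (scaled_coord r (side r k.+1) x j))
    (fun j => fine_tent (P j) (scaled_coord r (side r k.+1) x j)) j).
Proof.
have s0 : side r k.+1 ^+ n.+1 != 0 by rewrite expf_neq0// side_neq0.
have Ifine := integrable_mul_prod k.+1 (fun j => tame_fine_tent (P j)).
have Icoarse := integrable_mul_prod k.+1 (fun j => tame_coarse_tent (P j)).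
have -> : coefd k.+1 P = (side r k.+1 ^+ n.+1)^-1 *
    (\int[mu]_x (u x * \prod_j fine_tent (P j) (scaled_coord r (side r k.+1) x j)) -
     \int[mu]_x (u x * \prod_j coarse_tent (P j) (scaled_coord r (side r k.+1) x j))).
  rewrite mulrBr /coefd; congr (_ - _); rewrite /avg -!RintegralZl//; last first.
    exact: integrable_mul_weight.
  by apply: eq_Rintegral => x _; rewrite mulrCA coarse_weight mulrCA.
rewrite mulVKf// -RintegralB// -Rintegral_sum.
  by apply: eq_Rintegral => x _; rewrite -mulrBr prodB_hybrid mulr_sumr.
move=> i.
pose B (j : 'I_n.+1) := if (j < i)%N then coarse_tent (P j) else if j == i then
  fun t : R => fine_tent (P j) t - coarse_tent (P j) t else fine_tent (P j).
rewrite (_ : (fun x => _) = fun x => u x * \prod_j B j (scaled_coord r (side r k.+1) x j)).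
  apply: integrable_mul_prod => j; rewrite /B; case: (j < i)%N.
    exact: tame_coarse_tent.
  by case: (j == i); [exact: tame_tentB|exact: tame_fine_tent].
apply/funext => x; congr (_ * _); apply: eq_bigr => j _; rewrite /hybrid /B.
by case: (j < i)%N => //; case: (j == i).
Qed.

Lemma v_ge0 : 0 <= v.
Proof. by rewrite -lee_fin -uv Valpha_ge0. Qed.

Lemma coefd_sum_le k :
  side r k ^+ n.+1 * \sum_(p : {ffun 'I_n.+1 -> 'I_(2 ^ k)}) `|coefd k (fun j => p j)|
  <= n.+1%:R * (v * test_bound k).
Proof.
have sd : 0 <= side r k ^+ n.+1 by rewrite exprn_ge0// ltW// side_gt0.
pose s (p : {ffun 'I_n.+1 -> 'I_(2 ^ k)}) := Num.sg (coefd k (fun j => p j)).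
have s1 p : `|s p| <= 1 by rewrite /s normr_sg; case: (_ == _).
have -> : side r k ^+ n.+1 *
    \sum_(p : {ffun 'I_n.+1 -> 'I_(2 ^ k)}) `|coefd k (fun j => p j)| =
    \sum_p s p * (side r k ^+ n.+1 * coefd k (fun j => p j)).
  by rewrite mulr_sumr; apply: eq_bigr => p _; rewrite mulrCA -normrEsg.
clear sd; case: k s s1 => [|k] s s1.
(* At level 0 the only index is 0 and nothing telescopes: the weight itself is a derivative in
   direction [ord0], with the bounded primitive [ramp] in that slot. *)
- pose A (j : 'I_n.+1) (m : 'I_(2 ^ 0)) : R -> R :=
    if j == ord0 then fun t => ramp (t - m%:R) else fine_tent m.
  have m0 (m : 'I_(2 ^ 0)) : (m : nat) = 0%N by case: m => -[].
  have := @tensor_test_le 0 _ A s ord0 (fun m => fine_tent m) _ s1.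
  have -> : \sum_p s p * \int[mu]_x (u x * \prod_j
      (if j == ord0 then (fun m : 'I_(2 ^ 0) => fine_tent m) else A j) (p j)
        (scaled_coord r (side r 0) x j)) =
      \sum_p s p * (side r 0 ^+ n.+1 * coefd 0 (fun j => p j)).
    apply: eq_bigr => p _; congr (_ * _).
    rewrite /coefd subr0 /avg mulVKf ?expf_neq0 ?side_neq0//.
    apply: eq_Rintegral => x _; congr (_ * _); apply: eq_bigr => j _.
    by rewrite /A; case: eqVneq.
  move=> H; apply: le_trans (ler_norm _) _.
  apply: (@le_trans _ _ (v * test_bound 0)).
    apply: H => [j|m t|j m].
    + rewrite /A; case: (j == ord0); last exact: lip_fine_tent.
      rewrite (_ : (fun m : 'I_(2 ^ 0) => _) = fun=> ramp); last first.
        by apply/funext => m; apply/funext => t; rewrite m0 subr0.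
      apply: lip_single => [t|t s'].
        by have := ramp_itv t => /andP[? ?]; rewrite ger0_norm//; lra.
      by have := ramp_lip t s'; have := normr_ge0 (t - s'); lra.
    + rewrite /A eqxx m0 (_ : (fun t => _) = ramp) /fine_tent ?subr0.
        exact: is_derive_ramp.
      by apply/funext => t'; rewrite subr0.
    + by rewrite /A; case: (j == ord0); exact: tame_fine_tent.
  by rewrite ler_peMl ?ler1n// mulr_ge0 ?v_ge0// ltW// test_bound_gt0.
(* Slots before [i] are coarse, slots after [i] are fine, and slot [i] holds the primitive:
   differentiating in direction [i] restores the [i]-th summand of [coefdS]. *)
- pose A (i j : 'I_n.+1) (m : 'I_(2 ^ k.+1)) : R -> R :=
    if (j < i)%N then coarse_tent m else if j == i then ramp_diff m else fine_tent m.
  pose a (m : 'I_(2 ^ k.+1)) (t : R) := fine_tent m t - coarse_tent m t.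
  have -> : \sum_p s p * (side r k.+1 ^+ n.+1 * coefd k.+1 (fun j => p j)) =
      \sum_i \sum_p s p * \int[mu]_x (u x * \prod_j
        (if j == i then a else A i j) (p j) (scaled_coord r (side r k.+1) x j)).
    rewrite exchange_big/=; apply: eq_bigr => p _; rewrite -mulr_sumr; congr (_ * _).
    rewrite coefdS; apply: eq_bigr => i _; apply: eq_Rintegral => x _.
    congr (_ * _); apply: eq_bigr => j _; rewrite /hybrid /A /a.
    by case: (eqVneq j i) => [->|_]; rewrite ?ltnn//; case: (j < i)%N.
  apply: (@le_trans _ _ (\sum_(i < n.+1) (v * test_bound k.+1))); last first.
    by rewrite sumr_const card_ord mulr_natl.
  apply: ler_sum => i _; apply: le_trans (ler_norm _) _.
  apply: tensor_test_le => // [j|m t|j m].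
  + rewrite /A; case: (j < i)%N; first exact: lip_coarse_tent.
    by case: (j == i); [exact: lip_ramp_diff|exact: lip_fine_tent].
  + by rewrite /A ltnn eqxx; exact: is_derive_ramp_diff.
  + case: (eqVneq j i) => [_|/negPf ji]; first exact: tame_tentB.
    rewrite /A ji; case: (j < i)%N; [exact: tame_coarse_tent|exact: tame_fine_tent].
Qed.

End coefficients.

(** * Supports and dyadic form of step functions *)

Section supports.
Context {R : realType}.
Variables (d : nat) (r : R).
Hypothesis r0 : 0 < r.

Lemma closed_spt (f : 'rV[R]_d -> R) : closed (spt f).
Proof.
rewrite -openC openE => x /= /existsNP[U /not_implyP[[oU Ux] /contrapT fU]].
apply: (@filterS _ _ _ U); last exact: open_nbhs_nbhs.
by move=> y Uy /(_ U (conj oU Uy)).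
Qed.

Lemma spt_step k c : spt (step (d := d) r k c) `<=` cube r.
Proof.
move=> x xs; apply: contrapT => Qx; apply: (xs (~` cube r)).
  by split=> //; apply: closed_openC; exact: closed_box.
by apply: aeW => y Qy; exact: step_outside.
Qed.

Lemma L1c_step k c : L1c (step (d := d) r k c).
Proof.
split; first exact: integrable_step.
apply: (@subclosed_compact _ _ (cube r)); first exact: closed_spt.
  exact: compact_box.
exact: spt_step.
Qed.

Lemma cell_dyadic k (P : 'I_d -> nat) : (forall j, (P j < 2 ^ k)%N) ->
  dyadic r k (cell r k P).
Proof.
case: k => [|k] Pk /=.
  by apply: cell0 => j; have := Pk j; rewrite expn0 ltnS leqn0 => /eqP.
(* Since [r] is [2 ^ k] sides of level [k.+1], the corner at [- r] lies on the integer grid and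
   indices shift by [2 ^ k]. At level 0 it would lie half a side off, whence the separate case. *)
exists (\row_j ((P j)%:Z - (2 ^ k)%:Z)) => //.
have -> : r * 2 ^ (1 - k.+1%:Z) = side r k.+1.
  rewrite (_ : 1 - k.+1%:Z = - k%:Z); last by rewrite -addn1 PoszD opprD addrCA subrr addr0.
  by rewrite -exprnN /side exprS; field; rewrite expf_neq0.
have s0 := side_gt0 r0 k.+1.
have rE : r = side r k.+1 * 2 ^+ k by rewrite /side exprS; field; rewrite expf_neq0.
have E j (y : R) : - r + side r k.+1 * ((P j)%:R + y) =
    side r k.+1 * ((((P j)%:Z - (2 ^ k)%:Z)%:~R) + y).
  have -> : - r = - (side r k.+1 * 2 ^+ k) by rewrite -rE.
  by rewrite rmorphB/= -!pmulrn natrX; ring.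
apply/seteqP; split=> [_ [y y01 <-] j|x xP].
  rewrite !mxE -E; have /andP[? ?] := y01 j.
  by rewrite -natr1 -{1}[(P j)%:R]addr0 !lerD2l !ler_pM2l// !lerD2l; apply/andP.
exists (\row_j (scaled_coord r (side r k.+1) x j - (P j)%:R)).
  move=> j; rewrite mxE /scaled_coord; have /andP[/= x1 x2] := xP j.
  rewrite subr_ge0 lerBlDl natr1 ler_pdivlMr// ler_pdivrMr//.
  by rewrite ![_ * side r k.+1]mulrC; apply/andP; split; lra.
apply/rowP => j; rewrite !mxE -E /scaled_coord; field.
by rewrite gt_eqF.
Qed.

Lemma step_dyadic k c : exists a : set 'rV[R]_d -> R, forall x,
  step r k c x = \sum_(Q \in dyadic r k) (a Q * \1_Q x).
Proof.
pose C (p : {ffun 'I_d -> 'I_(2 ^ k)}) : set 'rV[R]_d := cell r k (fun j => p j).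
(* Adding over all [p] with [C p = Q] defines [a] without having to show that distinct indices give
   distinct cells. *)
pose a (Q : set 'rV[R]_d) : R :=
  \sum_(p : {ffun 'I_d -> 'I_(2 ^ k)}) c (fun j => p j) * (Q == C p)%:R.
exists a => x.
pose s := undup [seq C p | p <- enum {ffun 'I_d -> 'I_(2 ^ k)}].
have sC p : C p \in s by rewrite mem_undup; apply: map_f; rewrite mem_enum.
have sD Q : Q \in s -> dyadic r k Q.
  rewrite mem_undup => /mapP[p _ ->]; apply: cell_dyadic => j; exact: ltn_ord.
rewrite (@fsbigE _ _ _ _ _ s); first last.
- move=> Q _ Qs; rewrite /a big1 ?mul0r// => p _.
  by case: eqP => [QE|_]; [rewrite QE sC in Qs|rewrite mulr0].
- by move=> Q /= /sD.
- exact: undup_uniq.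
transitivity (\sum_(Q <- s) a Q * \1_Q x); last first.
  by rewrite [RHS]big_mkcond; apply: eq_big_seq => Q /sD/mem_set ->.
under eq_bigr do rewrite /a mulr_suml.
rewrite exchange_big/=; apply: eq_bigr => p _.
rewrite (bigD1_seq (C p))/=; [|exact: sC|exact: undup_uniq].
rewrite eqxx mulr1 big1 ?addr0// => Q /negPf QC.
by rewrite QC mulr0 mul0r.
Qed.

End supports.

(** * Telescoping of the pieces and convergence *)

Section decomposition.
Context {R : realType}.
Variables (n : nat) (r : R) (u : 'rV[R]_n.+1 -> R).
Hypothesis r0 : 0 < r.
Hypothesis ui : (@lebesgue_rV R n.+1).-integrable setT (EFin \o u).
Let mu := @lebesgue_rV R n.+1.

Definition piece k : 'rV[R]_n.+1 -> R := step r k (coefd r u k).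

(** The ancestors of a cell containing [x] contain [x] too; at a generic point each [piece] takes
    the coefficient of one such ancestor, and these telescope. *)
Lemma sum_piece_cell N x (p : {ffun 'I_n.+1 -> 'I_(2 ^ N)}) : generic r x ->
  cell r N (fun j => p j) x ->
  \sum_(k < N.+1) piece k x = avg r u N (fun j => p j).
Proof.
move=> gx; elim: N p => [|N IH] p xp.
  by rewrite big_ord1 /piece (step_generic r0 _ gx xp) /coefd subr0.
rewrite big_ord_recr/= /piece (step_generic r0 _ gx xp) /coefd.
have halfN m : (m < 2 ^ N.+1 -> m./2 < 2 ^ N)%N by rewrite expnS; lia.
have pN j : ((p j)./2 < 2 ^ N)%N by apply: halfN; exact: ltn_ord.
pose q : {ffun 'I_n.+1 -> 'I_(2 ^ N)} := [ffun j => Ordinal (pN j)].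
have qE : (fun j => (p j)./2) = (fun j => q j : nat).
  by apply/funext => j; rewrite ffunE.
rewrite (IH q); first by rewrite qE addrC subrK.
by rewrite -qE; exact: cell_parent.
Qed.

Lemma sum_piece N x : generic r x ->
  \sum_(k < N.+1) piece k x = approx r u N x.
Proof.
move=> gx; have [Qx|Qx] := pselect (cube r x); last first.
  rewrite /approx step_outside// big1// => k _; exact: step_outside.
have [p xp] := generic_cell_ex r0 N gx Qx.
by rewrite (sum_piece_cell gx xp) /approx (step_generic r0 _ gx xp).
Qed.

Lemma Lnorm1_real (f : 'rV[R]_n.+1 -> R) : mu.-integrable setT (EFin \o f) ->
  ('N[mu]_1 [EFin \o f] = (\int[mu]_x `|f x|)%:E)%E.
Proof.
move=> fi; rewrite Lnorm1 /Rintegral fineK//.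
by apply: integrable_fin_num => //; exact: integrable_normr.
Qed.

Lemma integrable_restrict_cube :
  mu.-integrable setT (EFin \o (fun x => \1_(cube r) x * u x)).
Proof.
have mQ : measurable (@cube R n.+1 r) by exact: measurable_cube.
rewrite indicM -restrict_EFin; apply/(integrable_mkcond _ mQ).
exact: (integrableS measurableT mQ _ ui).
Qed.

Lemma sum_piece_cvg : spt u `<=` cube r ->
  (fun N : nat => 'N[mu]_1 [EFin \o (fun x => u x - \sum_(k < N) piece k x)%R])%E
    @ \oo --> 0%E.
Proof.
(* The support condition makes [u] vanish off the cube only almost everywhere; [w] vanishes there
   everywhere and has the same averages on the cells of the cube. *)
move=> sptu; pose w x := \1_(cube r) x * u x.
have wi : mu.-integrable setT (EFin \o w) := integrable_restrict_cube.
have w0 x : ~ cube r x -> w x = 0 by move=> Qx; rewrite /w indicE memNset// mul0r.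
have [_ wK] := approximable_integrable r0 wi w0.
have pi (k : nat) : mu.-integrable setT (EFin \o piece k) by exact: integrable_step.
have ae_u : {ae mu, forall x, ~ cube r x -> u x = 0}.
  by apply: spt_sub_ae => //; exact: closed_box.
have err_piece N : ('N[mu]_1 [EFin \o (fun x => u x - \sum_(k < N.+1) piece k x)%R])%E =
    (err r w N)%:E.
  have If : mu.-integrable setT (EFin \o (fun x => u x - \sum_(k < N.+1) piece k x)).
    apply: integrable_sub => //; exact: integrable_sumr.
  have Ig := integrable_err r0 N wi.
  rewrite /err -Lnorm1_real// !Lnorm1; apply: ae_eq_integral => //.
  - by apply: measurableT_comp => //; exact: measurable_int If.
  - by apply: measurableT_comp => //; exact: measurable_int Ig.
  apply: filterS2 ae_u (ae_generic n.+1 r) => x ux gx _ /=.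
  rewrite sum_piece//; congr (`| _%:E |)%E; congr (_ - _).
    have [Qx|Qx] := pselect (cube r x); first by rewrite /w indicE mem_set// mul1r.
    by rewrite ux// w0.
  rewrite /approx /step; apply: eq_bigr => p _; congr (_ * _).
  apply: avg_eq_cube => // y Qy.
  by rewrite /w indicE mem_set// mul1r.
(* The empty sum is not a weighted average: it is [N.+1] pieces that add up to [approx] at level
   [N]. *)
rewrite -(cvg_shiftS _).
rewrite (_ : [sequence _]_k = EFin \o err r w); last by apply/funext => N; exact: err_piece.
by apply: cvg_EFin; [exact: nearW|exact: wK].
Qed.

End decomposition.

(** * Norm and variation bounds with explicit constant *)

Section estimates.
Context {R : realType}.
Variables (n : nat) (r alpha v : R) (u : 'rV[R]_n.+1 -> R).
Hypothesis r0 : 0 < r.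
Hypothesis alpha01 : 0 <= alpha < 1.
Hypothesis ui : (@lebesgue_rV R n.+1).-integrable setT (EFin \o u).
Hypothesis uv : Valpha alpha u = v%:E.

(** The factors [n.+1] come from the number of telescoping directions, from the Lipschitz constant
    of a product and from the perimeter-to-volume ratio of a cube. The 4 is 2 from the Hoelder bound
    times 2 from [side_powR]; 32 is the one-dimensional family bound. *)
Definition decomposition_cst : R := 4 * n.+1%:R ^+ 3 * 32 ^+ n.+1.

Lemma side_powR k : side r k `^ (1 - alpha) <=
  2 * (r `^ (1 - alpha) * 2 `^ (k%:R * (alpha - 1))).
Proof.
have /andP[a0 a1] := alpha01.
rewrite /side powRM ?invr_ge0 ?exprn_ge0 ?mulr_ge0 ?(ltW r0)// powRM ?(ltW r0)//.
rewrite -powR_invn// -powRrM (_ : - k%:R * (1 - alpha) = k%:R * (alpha - 1)); last ring.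
rewrite -mulrA ler_wpM2r ?mulr_ge0 ?powR_ge0//.
(* The power [1 - alpha] of 2 is at most 2 because [alpha >= 0]; this removes the last dependence of
   the constant on [alpha]. *)
rewrite -[leRHS](@powRr1 _ 2)// ler_powR ?ler1n//; lra.
Qed.

(* The extra factor [n.+1] of [decomposition_cst] only serves the variation bound. *)
Let cst0 : R := 4 * n.+1%:R ^+ 2 * 32 ^+ n.+1.

Let decomposition_cstE : decomposition_cst = n.+1%:R * cst0.
Proof. by rewrite /decomposition_cst /cst0; ring. Qed.

Lemma piece_coef_sum k :
  side r k ^+ n.+1 * \sum_(p : {ffun 'I_n.+1 -> 'I_(2 ^ k)}) `|coefd r u k (fun j => p j)|
  <= 4 * n.+1%:R ^+ 2 * 32 ^+ n.+1 * v *
     (r `^ (1 - alpha) * 2 `^ (k%:R * (alpha - 1))).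
Proof.
have v0 := v_ge0 uv.
apply: le_trans (coefd_sum_le r0 alpha01 ui uv k) _; rewrite /test_bound.
have -> : n.+1%:R * (v * (2 * n.+1%:R * 32 ^+ n.+1 * side r k `^ (1 - alpha))) =
  2 * n.+1%:R ^+ 2 * 32 ^+ n.+1 * v * side r k `^ (1 - alpha) by ring.
apply: le_trans (ler_wpM2l _ (side_powR k)) _.
  by rewrite !mulr_ge0// exprn_ge0.
by rewrite le_eqVlt; apply/orP; left; apply/eqP; ring.
Qed.

Lemma piece_L1 k : ('N[@lebesgue_rV R n.+1]_1 [EFin \o piece r u k] <=
  (decomposition_cst * r `^ (1 - alpha))%:E * Valpha alpha u
    * (2 `^ (k%:R * (alpha - 1)))%:E)%E.
Proof.
rewrite uv Lnorm1_real -?EFinM ?lee_fin; last exact: integrable_step.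
apply: le_trans (step_L1 r0 k _) _; apply: le_trans (piece_coef_sum k) _.
rewrite decomposition_cstE -/cst0.
rewrite (_ : n.+1%:R * cst0 * r `^ (1 - alpha) * v * 2 `^ (k%:R * (alpha - 1)) =
  n.+1%:R * (cst0 * v * (r `^ (1 - alpha) * 2 `^ (k%:R * (alpha - 1))))); last ring.
by rewrite ler_peMl ?ler1n// !mulr_ge0 ?powR_ge0 ?exprn_ge0 ?(v_ge0 uv).
Qed.

Lemma piece_Vtot k : (Vtot (piece r u k) <=
  (decomposition_cst * r `^ (- alpha))%:E * Valpha alpha u
    * (2 `^ (k%:R * alpha))%:E)%E.
Proof.
have s0 := side_gt0 r0 k.
have := Vtot_step_le (fun p : {ffun 'I_n.+1 -> 'I_(2 ^ k)} => coefd r u k (fun j => p j))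
  (ltW s0) (fun p j => cell_side r k (fun j => p j) j).
move=> /le_trans; apply; rewrite uv -!EFinM lee_fin.
set S := \sum_p _.
(* The perimeter-to-volume ratio [2 * n.+1 / side r k] equals [n.+1 * 2 ^ k / r]. Its factor 1 / r
   lowers the exponent of [r] to [- alpha], and its [2 ^ k] raises that of 2 to [k * alpha]. *)
have -> : 2 * n.+1%:R * side r k ^+ n * S =
    n.+1%:R * 2 ^+ k / r * (side r k ^+ n.+1 * S).
  have -> : n.+1%:R * 2 ^+ k / r = 2 * n.+1%:R / side r k.
    by rewrite /side; field; rewrite expf_neq0//= gt_eqF.
  by rewrite exprS; field; rewrite gt_eqF.
apply: le_trans (ler_wpM2l _ (piece_coef_sum k)) _.
  by rewrite divr_ge0 ?(ltW r0)// mulr_ge0// exprn_ge0.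
have -> : r `^ (1 - alpha) = r * r `^ (- alpha).
  by rewrite (powRD (r := 1)) ?powRr1 ?(ltW r0)// (gt_eqF r0) implybT.
have -> : 2 `^ (k%:R * alpha) = 2 ^+ k * 2 `^ (k%:R * (alpha - 1)) :> R.
  rewrite -powR_mulrn// -powRD; last by rewrite pnatr_eq0 implybT.
  by congr (_ `^ _); ring.
rewrite le_eqVlt; apply/orP; left; apply/eqP; rewrite /decomposition_cst; field.
by rewrite gt_eqF.
Qed.

End estimates.

Unset Implicit Arguments.

Theorem theorem3p3 (R : realType) (n : nat) :
  exists2 C : R, 0 <= C &
  forall (alpha r : R) (u : 'rV[R]_n.+1 -> R),
    0 <= alpha < 1 -> BVac alpha u -> 0 < r -> spt u `<=` cube r ->
  exists u_ : nat -> 'rV[R]_n.+1 -> R,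
    [/\ forall k, BVc (u_ k),
        (fun N : nat => 'N[@lebesgue_rV R n.+1]_1
           [EFin \o (fun x => u x - \sum_(k < N) u_ k x)%R])%E @ \oo --> 0%E,
        forall k, spt (u_ k) `<=` cube r,
        forall k,
          ('N[@lebesgue_rV R n.+1]_1 [EFin \o u_ k] <=
             (C * r `^ (1 - alpha))%:E * Valpha alpha u
               * (2 `^ (k%:R * (alpha - 1)))%:E)%E /\
          (Vtot (u_ k) <=
             (C * r `^ (- alpha))%:E * Valpha alpha u
               * (2 `^ (k%:R * alpha))%:E)%E
      & forall k, exists a : set 'rV[R]_n.+1 -> R, forall x,
          u_ k x = \sum_(Q \in dyadic r k) (a Q * \1_Q x)].
Proof.
exists (decomposition_cst n); first by rewrite !mulr_ge0// exprn_ge0.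
move=> alpha r u alpha01 [[ui _] uoo] r0 sptu.
have uv : Valpha alpha u = (fine (Valpha alpha u))%:E.
  by rewrite fineK// ge0_fin_numE// Valpha_ge0.
exists (piece r u); split.
- move=> k; split; first exact: L1c_step.
  apply: le_lt_trans (piece_Vtot r0 alpha01 ui uv k) _.
  by rewrite uv -!EFinM ltry.
- exact: sum_piece_cvg.
- by move=> k; exact: spt_step.
- by move=> k; split; [exact: piece_L1 uv k|exact: piece_Vtot uv k].
- by move=> k; exact: step_dyadic.
Qed.
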